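(* There exist an absolute constant $c>0$ and a function $\eta:\{2,3,\dots\}\to\mathbb{R}$ with $\eta(n)\to 0$ as $n\to\infty$ such that for every integer $n\ge 2$, $$ 3-(1+\eta(n))\log_n\frac{3\sqrt3}{4}\;\le\; t_n\;\le\; 3-\log_n(1+c). $$
   Context: For a finite subset $A$ of an abelian group, its additive energy is $E(A)=\#\{(a_1,a_2,a_3,a_4)\in A^4: a_1+a_2=a_3+a_4\}$. For an integer $n\ge2$, $t_n$ denotes the smallest real number such that $E(A)\le |A|^{t_n}$ for every positive integer $d$ and every subset $A\subset\{0,1,\dots,n-1\}^d$ (viewed in $\mathbb{Z}^d$). *)

(* Defs.v *)
From HB Require Import structures.
From mathcomp Require Import all_boot all_order all_algebra finmap.
From mathcomp Require Import all_classical all_reals all_analysis.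
Set Implicit Arguments.
Unset Strict Implicit.
Unset Printing Implicit Defensive.
Import Order.TTheory GRing.Theory Num.Theory.
Import numFieldNormedType.Exports.
Local Open Scope classical_set_scope.
Local Open Scope ring_scope.

(* A quadruple q = (a1, a2, a3, a4) is left-nested. *)
Definition additive_energy (G : zmodType) (A : {fset G}) : nat :=
  #|` [fset q in (A `*` A `*` A `*` A)%fset
       | (q.1.1.1 + q.1.1.2 == q.1.2 + q.2)%R]%fset |.

Definition in_cube (n d : nat) (A : {fset 'rV[int]_d}) : Prop :=
  forall a : 'rV[int]_d, a \in A -> forall i : 'I_d, 0 <= a ord0 i < n%:Z.

Definition admissible_exponents (R : realType) (n : nat) : set R :=
  [set t : R | forall (d : nat) (A : {fset 'rV[int]_d}),
    (0 < d)%N -> in_cube n A ->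
    (additive_energy A)%:R <= (#|` A|%fset)%:R `^ t].

(* The infimum is attained when 2 <= n: see [energy_exponent_smallest]. *)
Definition energy_exponent (R : realType) (n : nat) : R :=
  inf (@admissible_exponents R n).

Definition log_base (R : realType) (b x : R) : R := ln x / ln b.

Lemma cardfsM (T T' : choiceType) (A : {fset T}) (B : {fset T'}) :
  #|` (A `*` B)%fset|%fset = (#|` A|%fset * #|` B|%fset)%N.
Proof.
rewrite (perm_size (enum_imfset2 _ _)) ?size_allpairs//.
by move=> [? ?] [? ?] _ _ /= [-> ->].
Qed.

Lemma additive_energy_le (G : zmodType) (A : {fset G}) :
  (additive_energy A <= (#|` A|%fset) ^ 4)%N.
Proof.
apply: leq_trans (fsubset_leq_card (fset_sub _ _)) _.
by rewrite !cardfsM !expnS expn0 muln1 !mulnA.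
Qed.

Lemma additive_energy_gt0 (G : zmodType) (A : {fset G}) (a : G) :
  a \in A -> (0 < additive_energy A)%N.
Proof.
move=> aA; rewrite cardfs_gt0; apply/fset0Pn; exists (a, a, a, a).
by rewrite !inE /= aA eqxx.
Qed.

Lemma energy_exponent_smallest (R : realType) (n : nat) : (2 <= n)%N ->
  @admissible_exponents R n (energy_exponent R n) /\
  lbound (@admissible_exponents R n) (energy_exponent R n).
Proof.
move=> n2.
have ne : @admissible_exponents R n !=set0.
  exists 4%:R => d A _ _; rewrite powR_mulrn ?ler0n//.
  by rewrite -natrX ler_nat additive_energy_le.
have lb : has_lbound (@admissible_exponents R n).
  exists 0 => t /(_ 1%N [fset 0; const_mx 1]%fset isT) h.
  have neq : (0 : 'rV[int]_1) != const_mx 1.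
    by apply/eqP => /rowP/(_ ord0); rewrite !mxE.
  have cube : in_cube n [fset (0 : 'rV[int]_1); const_mx 1]%fset.
    move=> a; rewrite !inE => /orP[] /eqP -> i; rewrite mxE /= ?lexx ?ltz_nat //.
    by rewrite (leq_trans _ n2).
  have := h cube; rewrite cardfs2 neq /= => {}h.
  have : 1 <= (2%:R : R) `^ t.
    apply: le_trans h; rewrite ler1n.
    by apply: (@additive_energy_gt0 _ _ 0); rewrite !inE eqxx.
  rewrite -ler_ln ?posrE ?powR_gt0 ?ltr0n// ln1 ln_powR pmulr_lge0//.
  by rewrite ln_gt0// ltr1n.
split; last exact: ge_inf.
move=> d A d0 cubeA.
have [->|/fset0Pn[a aA]] := eqVneq A fset0.
  suff -> : additive_energy (fset0 : {fset 'rV[int]_d}) = 0%N by exact: powR_ge0.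
  by apply/eqP; rewrite -leqn0 (leq_trans (additive_energy_le _))// cardfs0.
have A0 : (0 < #|` A|%fset)%N by rewrite cardfs_gt0; apply/fset0Pn; exists a.
have E0 := additive_energy_gt0 aA.
have [A1|A1] := leqP #|` A|%fset 1.
  have A1' : #|` A|%fset = 1%N by apply/eqP; rewrite eqn_leq A1.
  rewrite A1' powR1 lern1; apply: leq_trans (additive_energy_le A) _.
  by rewrite A1'.
have lnA : 0 < ln (#|` A|%fset)%:R :> R by rewrite ln_gt0// ltr1n.
rewrite -ler_ln ?posrE ?powR_gt0 ?ltr0n// ln_powR -ler_pdivrMr//.
apply: lb_le_inf => // t /(_ d A d0 cubeA).
by rewrite -ler_ln ?posrE ?powR_gt0 ?ltr0n// ln_powR -ler_pdivrMr.
Qed.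

(* Main.v *)
(* E is the fourth power of a norm satisfying E(f1, f2, f3, f4)^4 <= prod E(fi),
   so the bound E(f) <= |f|_q^4 with q = 4 / t tensorises: it holds on {0..n-1}^d
   as soon as it holds on {0..n-1}.

   Upper bound.  In dimension one, Young's inequality E(f) <= |f|_(4/3)^4 and
   Hoelder's inequality give E(f) <= n^(3-t) |f|_q^4, which loses n^(3-t) = 1 + c.
   Young's inequality gains a constant factor unless f is concentrated at a point:
   writing h = f^(4/3) and r = h^(1/2), one has (f * f)^2 <= (h * h) (r * r), and if
   r * r is close to its maximum at most sums then h is nearly symmetric about many
   centres, hence nearly invariant under a translation comparable to its own
   spread.  Near a point mass the claim follows from a direct expansion.

   Lower bound.  Splitting the tensor powers of f into level sets shows
   E(f) <= (sum f^(4/3))^t for the exponent t = t_n <= 3.  Sampled Gaussians of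
   width a small multiple of n almost attain the sharp constant 4 / (3 sqrt 3) of
   Young's inequality on the line. *)
Require Import Defs.
From HB Require Import structures.
From mathcomp Require Import all_boot all_order all_algebra finmap.
From mathcomp Require Import all_classical all_reals all_analysis.
From mathcomp Require Import ring lra zify.
Set Implicit Arguments.
Unset Strict Implicit.
Unset Printing Implicit Defensive.
Import Order.TTheory GRing.Theory Num.Theory.
Import numFieldNormedType.Exports.
Local Open Scope classical_set_scope.
Local Open Scope ring_scope.

(** * Cauchy-Schwarz for the additive energy *)

(** Lagrange's identity: twice the defect is the double sum of the squares of
    [u i * v j - u j * v i]. *)
Lemma sum_CauchySchwarz (R : realDomainType) (I : Type) (r : seq I)
    (P : pred I) (u v : I -> R) :
  (\sum_(i <- r | P i) u i * v i) ^+ 2 <=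
  (\sum_(i <- r | P i) u i ^+ 2) * (\sum_(i <- r | P i) v i ^+ 2).
Proof.
set A := \sum_(i <- r | P i) u i ^+ 2.
set B := \sum_(i <- r | P i) v i ^+ 2.
set C := \sum_(i <- r | P i) u i * v i.
have : 0 <= \sum_(i <- r | P i) \sum_(j <- r | P j)
    (u i * v j - u j * v i) ^+ 2.
  by apply: sumr_ge0 => i _; apply: sumr_ge0 => j _; exact: sqr_ge0.
have -> : \sum_(i <- r | P i) \sum_(j <- r | P j) (u i * v j - u j * v i) ^+ 2
   = A * B + B * A - 2 * (C * C).
  rewrite /A /B /C !mulr_suml mulr_sumr -big_split -sumrB/=.
  apply: eq_bigr => i _; rewrite !mulr_sumr -big_split -sumrB/=.
  by apply: eq_bigr => j _; ring.
by rewrite -expr2 => h; lra.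
Qed.

(* The bilinear form is positive semidefinite: it is the inner product of the
   push-forwards of [u] and [v] along [k]. *)
Lemma fiber_CauchySchwarz (R : realDomainType) (P : finType) (V : eqType)
    (k : P -> V) (u v : P -> R) :
  (\sum_(p : P * P | k p.1 == k p.2) u p.1 * v p.2) ^+ 2 <=
  (\sum_(p : P * P | k p.1 == k p.2) u p.1 * u p.2) *
  (\sum_(p : P * P | k p.1 == k p.2) v p.1 * v p.2).
Proof.
pose s := undup [seq k p | p <- enum P].
have ks p : k p \in s by rewrite mem_undup; apply: map_f; rewrite mem_enum.
have us : uniq s := undup_uniq _.
pose push (w : P -> R) g := \sum_(p | k p == g) w p.
have pushE (w w' : P -> R) :
    \sum_(p : P * P | k p.1 == k p.2) w p.1 * w' p.2 =
    \sum_(g <- s) push w g * push w' g.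
  transitivity (\sum_(p : P) \sum_(p' | k p == k p') w p * w' p').
    by rewrite pair_big_dep.
  transitivity (\sum_(g <- s) \sum_(p | k p == g)
      \sum_(p' | k p == k p') w p * w' p').
    rewrite [RHS](exchange_big_dep predT)//=; apply: eq_bigr => p _.
    rewrite (eq_bigl (pred1 (k p))); last first.
      by move=> g; rewrite /= eq_sym.
    by rewrite -[RHS]big_filter filter_pred1_uniq// big_seq1.
  apply: eq_bigr => g _; rewrite /push mulr_suml; apply: eq_bigr => p /eqP ->.
  by rewrite mulr_sumr; apply: eq_bigl => p'; rewrite eq_sym.
rewrite !pushE; apply: le_trans (sum_CauchySchwarz _ _ _ _) _.
by under eq_bigr do rewrite expr2; under [X in _ * X]eq_bigr do rewrite expr2.
Qed.

Section Energy.
Context {R : realDomainType} {I : finType} {V : zmodType}.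
Variable phi : I -> V.
Implicit Types f : I -> R.

Definition additive_quad (q : I * I * I * I) : bool :=
  phi q.1.1.1 + phi q.1.1.2 == phi q.1.2 + phi q.2.

Definition qprod f1 f2 f3 f4 (q : I * I * I * I) : R :=
  f1 q.1.1.1 * f2 q.1.1.2 * f3 q.1.2 * f4 q.2.

(** Functions live on a finite type and are compared through a map [phi] into the group, so that the
    interval, the cube and indicators of finite sets share one definition although the group is
    infinite. *)
Definition energy4 f1 f2 f3 f4 : R :=
  \sum_(q | additive_quad q) qprod f1 f2 f3 f4 q.

Definition energy f : R := energy4 f f f f.

Lemma energy4_ge0 f1 f2 f3 f4 :
  (forall x, 0 <= f1 x) -> (forall x, 0 <= f2 x) ->
  (forall x, 0 <= f3 x) -> (forall x, 0 <= f4 x) ->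
  0 <= energy4 f1 f2 f3 f4.
Proof.
by move=> h1 h2 h3 h4; apply: sumr_ge0 => q _; rewrite !mulr_ge0.
Qed.

Lemma energyZ (c : R) f : energy (fun x => c * f x) = c ^+ 4 * energy f.
Proof.
by rewrite /energy /energy4 mulr_sumr; apply: eq_bigr => q _; rewrite /qprod; ring.
Qed.

(** Group a quadruple into the pairs (a1, a2) and (a3, a4), each keyed by its sum, and apply
    [fiber_CauchySchwarz]. *)
Lemma energy4_sum_keys f1 f2 f3 f4 :
  energy4 f1 f2 f3 f4 ^+ 2 <= energy4 f1 f2 f1 f2 * energy4 f3 f4 f3 f4.
Proof.
pose sumk (p : I * I) := phi p.1 + phi p.2.
pose pr f g (p : I * I) := f p.1 * g p.2.
have eE g1 g2 g3 g4 : energy4 g1 g2 g3 g4 =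
    \sum_(p : (I * I) * (I * I) | sumk p.1 == sumk p.2)
      pr g1 g2 p.1 * pr g3 g4 p.2.
  rewrite /energy4 (reindex (fun p : (I * I) * (I * I) => (p.1, p.2.1, p.2.2))).
    by apply: eq_bigr => q _; rewrite /qprod /pr/= mulrA.
  apply: onW_bij; exists (fun q : I * I * I * I => (q.1.1, (q.1.2, q.2))).
    by move=> [[? ?] [? ?]].
  by move=> [[[? ?] ?] ?].
rewrite !eE; exact: fiber_CauchySchwarz.
Qed.

(** The equation a1 + a2 = a3 + a4 also reads a1 - a3 = a4 - a2: keyed by differences, one pair
    carries only [f1] and the other only [f2]. *)
Lemma energy4_diff_keys f1 f2 :
  energy4 f1 f2 f1 f2 ^+ 2 <= energy f1 * energy f2.
Proof.
pose diffk (p : I * I) := phi p.1 - phi p.2.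
pose pr f (p : I * I) := f p.1 * f p.2.
have eE f g : energy4 f g f g =
    \sum_(p : (I * I) * (I * I) | diffk p.1 == diffk p.2) pr f p.1 * pr g p.2.
  rewrite /energy4 (reindex (fun p : (I * I) * (I * I) =>
      (p.1.1, p.2.2, p.1.2, p.2.1))).
    apply: eq_big => [q|q _]; last by rewrite /qprod /pr/=; ring.
    rewrite /additive_quad /diffk/= -[RHS]subr_eq0 -[LHS]subr_eq0.
    by congr (_ == 0); rewrite [in LHS]opprD [in RHS]opprB addrACA.
  apply: onW_bij; exists (fun q : I * I * I * I => ((q.1.1.1, q.1.2), (q.2, q.1.1.2))).
    by move=> [[? ?] [? ?]].
  by move=> [[[? ?] ?] ?].
rewrite /energy !eE; exact: fiber_CauchySchwarz.
Qed.

(** Apply [energy4_sum_keys], then [energy4_diff_keys] to both factors; only the diagonal energies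
    remain. *)
Lemma energy4_le f1 f2 f3 f4 :
  (forall x, 0 <= f1 x) -> (forall x, 0 <= f2 x) ->
  (forall x, 0 <= f3 x) -> (forall x, 0 <= f4 x) ->
  energy4 f1 f2 f3 f4 ^+ 4 <= energy f1 * energy f2 * energy f3 * energy f4.
Proof.
move=> h1 h2 h3 h4.
rewrite (_ : _ ^+ 4 = (energy4 f1 f2 f3 f4 ^+ 2) ^+ 2); last by rewrite -exprM.
apply: (@le_trans _ _ ((energy4 f1 f2 f1 f2 * energy4 f3 f4 f3 f4) ^+ 2)).
  by rewrite lerXn2r ?nnegrE ?energy4_sum_keys ?sqr_ge0// mulr_ge0 ?energy4_ge0.
rewrite exprMn -mulrA; apply: ler_pM; rewrite ?sqr_ge0 ?energy4_diff_keys//.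
Qed.

End Energy.

(** * Stability of Young's inequality on an interval *)

Section Interval.
Context {R : realType} {n : nat}.
Implicit Types f h r w : 'I_n -> R.

Definition intv (x : 'I_n) : int := x%:Z.

Definition conv f (s : nat) : R :=
  \sum_(p : 'I_n * 'I_n | (p.1 + p.2 == s)%N) f p.1 * f p.2.

(** The strict inequality makes it vanish at 0, and makes x < a correspond to y >= s + 1 - a when x
    + y = s. *)
Definition cumul h (a : nat) : R := \sum_(x < n | (x < a)%N) h x.

Lemma ltn_add_double (x y : 'I_n) : (x + y < n.*2)%N.
Proof. by rewrite -addnn -addSn leq_add// ltnW. Qed.

Lemma sum_conv f :
  \sum_(s < n.*2) conv f s = (\sum_x f x) ^+ 2.
Proof.
have lt2 (p : 'I_n * 'I_n) := ltn_add_double p.1 p.2.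
rewrite expr2 big_distrlr/= pair_big/=.
by rewrite (partition_big (fun p : 'I_n * 'I_n => Ordinal (lt2 p)) predT).
Qed.

Lemma energy_conv f : energy intv f = \sum_(s < n.*2) conv f s ^+ 2.
Proof.
have lt2 (p : 'I_n * 'I_n) := ltn_add_double p.1 p.2.
rewrite /energy /energy4.
rewrite (partition_big (fun q : 'I_n * 'I_n * 'I_n * 'I_n => Ordinal (lt2 q.1.1))
  predT)//=.
apply: eq_bigr => s _; rewrite expr2 /conv big_distrlr/= pair_big/=.
rewrite (reindex (fun p : ('I_n * 'I_n) * ('I_n * 'I_n) => (p.1, p.2.1, p.2.2))).
  apply: eq_big => [p|p _]; last by rewrite /qprod/= mulrA.
  rewrite /additive_quad /intv -val_eqE/= -!PoszD eqz_nat andbC.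
  by case: eqP => //= ->; rewrite eq_sym.
apply: onW_bij; exists (fun q : 'I_n * 'I_n * 'I_n * 'I_n => (q.1.1, (q.1.2, q.2))).
  by move=> [[? ?] [? ?]].
by move=> [[[? ?] ?] ?].
Qed.

Lemma conv_ge0 f s : (forall x, 0 <= f x) -> 0 <= conv f s.
Proof. by move=> f0; apply: sumr_ge0 => p _; rewrite mulr_ge0. Qed.

(** On an antidiagonal the first coordinate determines the pair, so no [h x] is counted twice. *)
Lemma sum_antidiagonal1 h (Q : pred ('I_n * 'I_n)) (P : pred 'I_n) s :
  (forall x, 0 <= h x) ->
  (forall p, Q p -> (p.1 + p.2 = s)%N /\ P p.1) ->
  \sum_(p | Q p) h p.1 <= \sum_(x | P x) h x.
Proof.
move=> h0 QP.
have -> : \sum_(p | Q p) h p.1 = \sum_x \sum_(y | Q (x, y)) h x.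
  by rewrite pair_big_dep; apply: eq_bigl => -[].
rewrite [leRHS]big_mkcond/=; apply: ler_sum => x _.
case: (pickP (fun y => Q (x, y))) => [y Qy|noy]; last first.
  by rewrite big_pred0//; case: ifP.
have [/= sE ->] := QP _ Qy.
rewrite (big_pred1 y)// => z; apply/idP/eqP => [Qz|->//].
by have [/= zE _] := QP _ Qz; apply: val_inj => /=; lia.
Qed.

Lemma sum_antidiagonal2 h (Q : pred ('I_n * 'I_n)) (P : pred 'I_n) s :
  (forall x, 0 <= h x) ->
  (forall p, Q p -> (p.1 + p.2 = s)%N /\ P p.2) ->
  \sum_(p | Q p) h p.2 <= \sum_(x | P x) h x.
Proof.
move=> h0 QP.
rewrite (reindex (fun p : 'I_n * 'I_n => (p.2, p.1)))/=; last first.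
  by apply: onW_bij; exists (fun p : 'I_n * 'I_n => (p.2, p.1)) => -[].
apply: (@sum_antidiagonal1 _ (fun p => Q (p.2, p.1)) _ s) => // p /QP[/= <- ?].
by rewrite addnC.
Qed.

Lemma conv_CauchySchwarz f g h (s : nat) :
  (forall x, f x = g x * h x) ->
  conv f s ^+ 2 <= conv (fun x => g x ^+ 2) s * conv (fun x => h x ^+ 2) s.
Proof.
move=> fE.
rewrite /conv (eq_bigr (fun p : 'I_n * 'I_n => (g p.1 * g p.2) * (h p.1 * h p.2))).
  apply: le_trans (sum_CauchySchwarz _ _ _ _) _.
  under eq_bigr do rewrite exprMn.
  by under [X in _ * X <= _]eq_bigr do rewrite exprMn.
by move=> p _; rewrite !fE; ring.
Qed.

(** * Affinity of a probability with its reflections *)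

Section Stability.
Variables r : 'I_n -> R.
Hypothesis r0 : forall x, 0 <= r x.
Let h x := r x ^+ 2.
Hypothesis h1 : \sum_x h x = 1.

Let h0 x : 0 <= h x. Proof. exact: sqr_ge0. Qed.

Lemma le_cumul a b : (a <= b)%N -> cumul h a <= cumul h b.
Proof.
move=> ab; rewrite /cumul [leLHS]big_mkcond [leRHS]big_mkcond/=.
apply: ler_sum => x _; case: ifP => [xa|_]; last by case: ifP.
by rewrite (leq_trans xa).
Qed.

Lemma cumul_le1 a : cumul h a <= 1.
Proof.
rewrite /cumul -h1 [leLHS]big_mkcond/=.
by apply: ler_sum => x _; case: ifP.
Qed.

Lemma cumulC a : \sum_(x < n | ~~ (x < a)%N) h x = 1 - cumul h a.
Proof.
rewrite -[X in X - _]h1 [X in X - _](bigID (fun x : 'I_n => (x < a)%N))/=.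
by rewrite /cumul addrC addrK.
Qed.

(* [conv r s] is the Hellinger affinity between the probability [h] and its
   reflection [x |-> s - x], which exchanges [x < a] and [x >= b]. *)
Lemma cumul_reflection (s a b : nat) : (a + b = s.+1)%N ->
  (cumul h a + cumul h b - 1) ^+ 2 <= 1 - conv r s ^+ 2.
Proof.
move=> abs.
pose Q (p : 'I_n * 'I_n) := (p.1 + p.2 == s)%N && (p.1 < a)%N.
pose Q' (p : 'I_n * 'I_n) := (p.1 + p.2 == s)%N && ~~ (p.1 < a)%N.
pose A := \sum_(p : 'I_n * 'I_n | Q p) r p.1 * r p.2.
pose B := \sum_(p : 'I_n * 'I_n | Q' p) r p.1 * r p.2.
have -> : conv r s = A + B.
  by rewrite /conv (bigID (fun p : 'I_n * 'I_n => (p.1 < a)%N)).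
have A0 : 0 <= A by apply: sumr_ge0 => p _; rewrite mulr_ge0.
have B0 : 0 <= B by apply: sumr_ge0 => p _; rewrite mulr_ge0.
have hA : A ^+ 2 <= cumul h a * (1 - cumul h b).
  apply: le_trans (sum_CauchySchwarz _ _ _ _) _.
  apply: ler_pM; try by apply: sumr_ge0 => p _; exact: sqr_ge0.
    apply: (@sum_antidiagonal1 h _ _ s) => // p /andP[/eqP ? ?]; by split.
  rewrite -cumulC.
  apply: (@sum_antidiagonal2 h _ _ s) => // p /andP[/eqP ps pa]; split => //.
  by lia.
have hB : B ^+ 2 <= (1 - cumul h a) * cumul h b.
  apply: le_trans (sum_CauchySchwarz _ _ _ _) _.
  apply: ler_pM; try by apply: sumr_ge0 => p _; exact: sqr_ge0.
    rewrite -cumulC.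
    apply: (@sum_antidiagonal1 h _ _ s) => // p /andP[/eqP ? ?]; by split.
  apply: (@sum_antidiagonal2 h _ _ s) => // p /andP[/eqP ps pa]; split => //.
  by lia.
have c0 k : 0 <= cumul h k by apply: sumr_ge0.
move: (cumul h a) (cumul h b) (c0 a) (c0 b) (cumul_le1 a) (cumul_le1 b) hA hB.
move=> x y x0 y0 x1 y1 hA hB.
(* AM-GM, since (A B)^2 <= x (1 - x) y (1 - y). Adding the bounds on A^2 and B^2 gives (A + B)^2 <=
   1 - (x + y - 1)^2. *)
have : 2 * (A * B) <= x * (1 - x) + y * (1 - y).
  rewrite -(@ler_pXn2r _ 2)// ?nnegrE; [|by rewrite !mulr_ge0|by nra].
  have hAB : (A * B) ^+ 2 <= (x * (1 - y)) * ((1 - x) * y).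
    by rewrite exprMn ler_pM// sqr_ge0.
  have := sqr_ge0 (x * (1 - x) - y * (1 - y)).
  rewrite exprMn; move: hAB.
  rewrite (_ : x * (1 - y) * ((1 - x) * y) = (x * (1 - x)) * (y * (1 - y))); last by ring.
  move: (A * B) (x * (1 - x)) (y * (1 - y)) => P X Y; rewrite !expr2; lra.
move: hA hB; rewrite !expr2; lra.
Qed.

Section Spread.
Variable kappa : R.
Hypothesis kappa01 : 0 <= kappa <= 1.
Hypothesis hmax : forall x, h x <= 1 - kappa.

(** Sums at which the affinity nearly attains its upper bound 1. With this margin, 1 - (conv r s)^2
    <= kappa^2 / 16, whose square root is the kappa / 4 of [good_reflection]. *)
Let good s := 1 - kappa ^+ 2 / 32 <= conv r s.

Lemma good_reflection s a b : good s -> (a + b = s.+1)%N ->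
  `|cumul h a + cumul h b - 1| <= kappa / 4.
Proof.
move=> gs abs; have /andP[k0 k1] := kappa01.
rewrite -(@ler_pXn2r _ 2)// ?nnegrE ?divr_ge0//.
rewrite real_normK ?num_real//.
apply: le_trans (cumul_reflection abs) _.
have g2 : (1 - kappa ^+ 2 / 32) ^+ 2 <= conv r s ^+ 2.
  rewrite ler_pXn2r// nnegrE ?conv_ge0//.
  have : kappa ^+ 2 <= 1 by rewrite expr_le1.
  lra.
have := sqr_ge0 (kappa ^+ 2 / 32).
move: g2; rewrite !expr2; lra.
Qed.

(** Two successive reflections, in [s] and in [s'], compose to a translation by [s' - s]; each costs
    kappa / 4. *)
Lemma cumul_shift s s' a : good s -> good s' -> (s <= s')%N ->
  cumul h (a + (s' - s)) - cumul h a <= kappa / 2.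
Proof.
move=> gs gs' ss'.
have cz : cumul h 0 = 0 by rewrite /cumul big_pred0.
have [as1|as1] := leqP a s.+1.
  have e1 : (a + (s.+1 - a) = s.+1)%N by lia.
  have e2 : (a + (s' - s) + (s.+1 - a) = s'.+1)%N by lia.
  have := good_reflection gs e1; have := good_reflection gs' e2.
  rewrite !ler_norml => /andP[_ ?] /andP[? _]; lra.
(* For a > s + 1, the reflection of the empty initial segment shows that at most kappa / 4 of the
   mass lies beyond [s]. *)
have := good_reflection gs (addn0 _).
rewrite cz ler_norml => /andP[? _].
have := le_cumul (ltnW as1); have := cumul_le1 (a + (s' - s)).
have := kappa01; lra.
Qed.

(* Extreme good sums s1 <= s2 make h almost invariant under translation by
   s2 - s1, so that an interval of that length carries little mass besides an
   atom; yet every good sum lies between s1 and s2. *)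
Lemma good_mass : \sum_(s < n.*2 | good s) conv h s <= 1 - kappa / 2.
Proof.
have /andP[k0 k1] := kappa01.
case: (pickP (fun s : 'I_n.*2 => good s)) => [s0 gs0|nog]; last first.
  by rewrite big_pred0//; lra.
case: (@arg_minnP _ s0 (fun s : 'I_n.*2 => good s) (fun s => s : nat) gs0) => s1 gs1 min1.
case: (@arg_maxnP _ s0 (fun s : 'I_n.*2 => good s) (fun s => s : nat) gs0) => s2 gs2 max2.
have s12 : (s1 <= s2)%N := min1 _ gs2.
have inner (x : 'I_n) : \sum_(y < n | (s1 <= x + y <= s2)%N) h y <= 1 - kappa / 2.
  (* Truncated subtraction: for x > s1 the interval starts at 0, and its end s2 - x is still at most
     [a + k]. *)
  pose a := (s1 - x)%N; pose k := (s2 - s1)%N.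
  apply: (@le_trans _ _ (\sum_(y < n | (a <= y <= a + k)%N) h y)).
    rewrite [leLHS]big_mkcond [leRHS]big_mkcond/=; apply: ler_sum => y _.
    case: ifP => [/andP[y1 y2]|_]; last by case: ifP.
    by rewrite ifT// /a /k; lia.
  rewrite (bigID (fun y : 'I_n => (y < a + k)%N))/=.
  (* The closed interval has one point more than the half-open one controlled by [cumul_shift]; the
     endpoint [a + k] is the atom, bounded by [hmax]. *)
  apply: (@le_trans _ _ ((cumul h (a + k) - cumul h a) + (1 - kappa))).
    apply: lerD.
      rewrite lerBrDl /cumul (bigID (fun y : 'I_n => (y < a)%N)
        (fun y : 'I_n => (y < a + k)%N))/=.
      apply: lerD; rewrite le_eqVlt; apply/orP; left; apply/eqP.
        by apply: eq_bigl => y; lia.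
      by apply: eq_bigl => y; lia.
    have [lt|ge] := ltnP (a + k) n.
      rewrite (big_pred1 (Ordinal lt))// => y; rewrite /= -val_eqE/=; lia.
    rewrite big_pred0; first lra.
    by move=> y; have := ltn_ord y; lia.
  by have := cumul_shift a gs1 gs2 s12; rewrite -/k; lra.
apply: (@le_trans _ _ (\sum_x h x * \sum_(y < n | (s1 <= x + y <= s2)%N) h y)).
  have lt2 (p : 'I_n * 'I_n) := ltn_add_double p.1 p.2.
  under [leRHS]eq_bigr do rewrite mulr_sumr.
  rewrite [leRHS]pair_big_dep/=.
  rewrite [leRHS](partition_big (fun p : 'I_n * 'I_n => Ordinal (lt2 p)) predT)//=.
  rewrite [leLHS]big_mkcond/=; apply: ler_sum => s _.
  case: ifP => [gs|_]; last by apply: sumr_ge0 => p _; rewrite mulr_ge0.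
  rewrite /conv le_eqVlt; apply/orP; left; apply/eqP; apply: eq_bigl => p.
  have ss : (s1 <= s <= s2)%N by apply/andP; split; [exact: min1|exact: max2].
  by rewrite -val_eqE/=; case: eqP => [->|_]; rewrite ?ss ?andbF.
apply: (@le_trans _ _ (\sum_x h x * (1 - kappa / 2))).
  by apply: ler_sum => x _; rewrite ler_wpM2l.
by rewrite -mulr_suml h1 mul1r.
Qed.

(** Sums that are not good lose eta = kappa^2 / 32 through [conv r s], and by [good_mass] they carry
    at least kappa / 2 of the mass of [conv h]: the total loss is eta * kappa / 2. *)
Lemma sum_conv_affinity :
  \sum_(s < n.*2) conv h s * conv r s <= 1 - kappa ^+ 3 / 64.
Proof.
have /andP[k0 k1] := kappa01.
have r1 s : conv r s <= 1.
  rewrite -(@ler_pXn2r _ 2)// ?nnegrE ?conv_ge0// expr1n.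
  apply: le_trans (sum_CauchySchwarz _ _ _ _) _; rewrite -[leRHS]mulr1.
  apply: ler_pM; try by apply: sumr_ge0 => p _; exact: sqr_ge0.
    rewrite -[leRHS]h1.
    by apply: (@sum_antidiagonal1 h _ _ s) => // p /eqP.
  rewrite -[leRHS]h1.
  by apply: (@sum_antidiagonal2 h _ _ s) => // p /eqP.
have hc0 s : 0 <= conv h s by apply: conv_ge0.
pose eta := kappa ^+ 2 / 32.
apply: (@le_trans _ _ (\sum_(s < n.*2) ((1 - eta) * conv h s +
    (if good s then eta * conv h s else 0)))).
  apply: ler_sum => s _; have := hc0 s; have := r1 s.
  case: ifP => [_ ? ?|/negbT]; first by nra.
  by rewrite /good -ltNge -/eta => ? ? ?; nra.
rewrite big_split/= -mulr_sumr sum_conv h1 expr1n mulr1 -big_mkcond -mulr_sumr/=.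
have e0 : 0 <= eta by rewrite divr_ge0// sqr_ge0.
have := ler_wpM2l e0 good_mass.
by rewrite /eta (exprS _ 2); lra.
Qed.

End Spread.
End Stability.

(** Writing f = w^3 keeps the exponents integral: h = f^(4/3) is w^4, r is w^2, and w^3 = w^2 * w is
    the factorisation fed to [conv_CauchySchwarz]. *)
Lemma energy_cube_spread w kappa : (forall x, 0 <= w x) ->
  \sum_x w x ^+ 4 = 1 -> 0 <= kappa <= 1 -> (forall x, w x ^+ 4 <= 1 - kappa) ->
  energy intv (fun x => w x ^+ 3) <= 1 - kappa ^+ 3 / 64.
Proof.
move=> w0 w1 k01 wk; pose r x := w x ^+ 2.
have rE x : r x ^+ 2 = w x ^+ 4 by rewrite /r -exprM.
have r0 x : 0 <= r x := sqr_ge0 _.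
apply: le_trans (sum_conv_affinity r0 _ k01 _); last 2 first.
- by under eq_bigr do rewrite rE.
- by move=> x; rewrite rE.
rewrite energy_conv; apply: ler_sum => s _.
by apply: (conv_CauchySchwarz (g := r)) => x; rewrite /r -exprSr.
Qed.

End Interval.

(** * The one-dimensional inequality *)

Section PowerSums.
Context {R : realType}.

(** Tangent of a concave power at 1. With y = exp v, the bounds exp z >= 1 + z at z = (1 - a) v and
    z = - a v, weighted by a and 1 - a, cancel the terms linear in v. *)
Lemma powR_le_tangent (y a : R) : 0 <= y -> 0 < a <= 1 ->
  y `^ a <= 1 - a + a * y.
Proof.
move=> y0 /andP[a0 a1].
have [->|yn0] := eqVneq y 0; first by rewrite powR0 ?gt_eqF//; lra.
have {y0 yn0} y0 : 0 < y by rewrite lt_neqAle eq_sym yn0.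
rewrite -(@lnK _ y)// -expRM mulrC.
set v := ln y; have e1 := expR_ge1Dx (v - a * v); have e2 := expR_ge1Dx (- (a * v)).
have -> : expR v = expR (a * v) * expR (v - a * v) by rewrite -expRD; congr expR; ring.
have e3 : expR (a * v) * expR (- (a * v)) = 1 by rewrite expRxMexpNx_1.
have := expR_gt0 (a * v); move: (expR (a * v)) e3 => E e3 E0.
have := ler_wpM2l (ltW E0) e2; have := ler_wpM2l (ltW E0) e1.
rewrite e3 => h1 h2.
have := ler_wpM2l (ltW a0) h1.
have a1' : 0 <= 1 - a by lra.
have := ler_wpM2l a1' h2; lra.
Qed.

(** Jensen's inequality: scale [u] to mean 1 and sum the tangent bounds. *)
Lemma sum_powR_concave (n : nat) (u : 'I_n -> R) (a : R) :
  (forall x, 0 <= u x) -> 0 < a <= 1 ->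
  \sum_x u x `^ a <= n%:R `^ (1 - a) * (\sum_x u x) `^ a.
Proof.
move=> u0 a01; have /andP[a0 a1] := a01.
set U := \sum_x u x; have U0 : 0 <= U by apply: sumr_ge0.
have [UZ|UN0] := eqVneq U 0.
  rewrite big1 ?mulr_ge0 ?powR_ge0// => x _.
  have := psumr_eq0P (fun x _ => u0 x) UZ => -> //.
  by rewrite powR0 ?gt_eqF.
have {}U0 : 0 < U by rewrite lt_neqAle eq_sym UN0.
have n0 : (0 : R) < n%:R.
  rewrite ltr0n lt0n; apply: contra_neq UN0 => n0.
  by rewrite /U big1// => x _; exfalso; have := ltn_ord x; lia.
have nU : 0 <= n%:R / U by rewrite divr_ge0// (ltW U0).
have : \sum_x (n%:R / U * u x) `^ a <= n%:R.
  apply: (@le_trans _ _ (\sum_x (1 - a + a * (n%:R / U * u x)))).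
    by apply: ler_sum => x _; apply: powR_le_tangent => //; rewrite mulr_ge0.
  rewrite big_split/= sumr_const card_ord -mulr_sumr -mulr_sumr -/U.
  by rewrite divfK// -mulr_natr; lra.
under eq_bigr do rewrite powRM//.
rewrite -mulr_sumr powRM ?invr_ge0 ?(ltW U0) ?(ltW n0)// => h.
rewrite powRB ?(gt_eqF n0) ?implybT// powRr1 ?(ltW n0)//.
have na : 0 < n%:R `^ a :> R by rewrite powR_gt0.
have Ua : 0 < U `^ a by rewrite powR_gt0.
rewrite mulrAC ler_pdivlMr//; move: h.
rewrite -powR_inv1 ?(ltW U0)// -powRrM mulN1r powRN mulrAC ler_pdivrMr//.
by rewrite (mulrC (n%:R `^ a)).
Qed.

(** Write v^a = v * v^(a - 1) and bound the second factor by the same power of the whole sum. *)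
Lemma sum_powR_convex (I : finType) (v : I -> R) (a : R) :
  (forall x, 0 <= v x) -> 1 <= a ->
  \sum_x v x `^ a <= (\sum_x v x) `^ a.
Proof.
move=> v0 a1; have a0 : 0 < a by lra.
have V0 : 0 <= \sum_x v x by apply: sumr_ge0.
rewrite -(mulr_powRB1 V0 a0) mulr_suml; apply: ler_sum => x _.
rewrite -(mulr_powRB1 (v0 x) a0) ler_wpM2l//.
rewrite ge0_ler_powR ?nnegrE ?subr_ge0//.
by rewrite (bigD1 x)//= lerDl sumr_ge0.
Qed.

End PowerSums.

(* The l^q norm of [f] for q = 4 / t: it is |A| ^ (t / 4) at the indicator of A. *)
Definition pnorm {R : realType} {I : finType} (t : R) (f : I -> R) : R :=
  (\sum_x f x `^ (4 / t)) `^ (t / 4).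

Section OneDimension.
Context {R : realType} {n : nat}.
Implicit Types f g : 'I_n -> R.

Lemma energy_young_spread f (kappa : R) : (forall x, 0 <= f x) ->
  0 <= kappa <= 1 ->
  (forall x, f x `^ (4 / 3) <= (1 - kappa) * \sum_y f y `^ (4 / 3)) ->
  energy intv f <= (1 - kappa ^+ 3 / 64) * (\sum_y f y `^ (4 / 3)) ^+ 3.
Proof.
move=> f0 k01; set W := \sum_y _ => fW.
have W0 : 0 <= W by apply: sumr_ge0 => x _; exact: powR_ge0.
have [WZ|WN0] := eqVneq W 0.
  have fz x : f x = 0.
    apply: (@powR_eq0_eq0 _ _ (4 / 3)).
    exact: (psumr_eq0P (fun x _ => powR_ge0 _ _) WZ).
  rewrite WZ expr0n mulr0 /energy /energy4 big1// => q _.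
  by rewrite /qprod fz !mul0r.
have {}W0 : 0 < W by rewrite lt_neqAle eq_sym WN0.
(* Normalisation: w^4 = f^(4/3) / W has total mass 1, and the energy, of degree 4 in f = v^3 w^3,
   scales by v^12 = W^3. *)
pose v := W `^ (4^-1); have v0 : 0 < v by rewrite powR_gt0.
have v4 : v ^+ 4 = W.
  by rewrite -powR_mulrn ?powR_ge0// -powRrM mulVf// powRr1// (ltW W0).
pose w x := f x `^ (3^-1) / v.
have w0 x : 0 <= w x by rewrite divr_ge0 ?powR_ge0 ?(ltW v0).
have w4 x : w x ^+ 4 = f x `^ (4 / 3) / W.
  rewrite expr_div_n v4; congr (_ / _).
  by rewrite -powR_mulrn ?powR_ge0// -powRrM mulrC.
have w3 x : f x = v ^+ 3 * w x ^+ 3.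
  rewrite -exprMn mulrC divfK ?(gt_eqF v0)// -powR_mulrn ?powR_ge0// -powRrM.
  by rewrite mulVf// powRr1.
rewrite /energy (_ : f = fun x => v ^+ 3 * w x ^+ 3); last exact/funext.
rewrite -/(energy _ _) energyZ -exprM mulrC (_ : (3 * 4 = 4 * 3)%N)// exprM v4.
rewrite ler_wpM2r ?exprn_ge0 ?(ltW W0)//.
apply: energy_cube_spread => //.
  under eq_bigr do rewrite w4.
  by rewrite -mulr_suml divff.
by move=> x; rewrite w4 ler_pdivrMr.
Qed.

(** Apply [sum_powR_concave] to f^(4/t) with exponent t / 3, then cube. *)
Lemma young_holder f (t : R) : (forall x, 0 <= f x) -> 0 < t <= 3 ->
  (\sum_x f x `^ (4 / 3)) ^+ 3 <=
  n%:R `^ (3 - t) * (\sum_x f x `^ (4 / t)) `^ t.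
Proof.
move=> f0 /andP[t0 t3].
have U0 : 0 <= \sum_x f x `^ (4 / t) by apply: sumr_ge0 => x _; exact: powR_ge0.
have W0 : 0 <= \sum_x f x `^ (4 / 3) by apply: sumr_ge0 => x _; exact: powR_ge0.
have t01 : 0 < t / 3 <= 1 by apply/andP; split; lra.
have := sum_powR_concave (fun x => powR_ge0 (f x) (4 / t)) t01.
under eq_bigr.
  move=> x _; rewrite -powRrM (_ : 4 / t * (t / 3) = 4 / 3).
  over.
  by field; rewrite gt_eqF.
move=> h; rewrite -powR_mulrn//.
apply: le_trans (ge0_ler_powR _ _ _ h) _; rewrite ?nnegrE ?mulr_ge0 ?powR_ge0//.
rewrite powRM ?powR_ge0// -!powRrM divfK// mulrBl mul1r divfK//.
Qed.

Lemma energy_le_powR f (t : R) : (forall x, 0 <= f x) -> 0 < t <= 3 ->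
  energy intv f <= n%:R `^ (3 - t) * (\sum_x f x `^ (4 / t)) `^ t.
Proof.
move=> f0 t03; apply: le_trans (young_holder f0 t03).
(* At kappa = 0 the spread condition is automatic and what remains is Young's inequality. *)
have := @energy_young_spread f 0 f0.
rewrite expr0n/= mul0r subr0 !mul1r lexx ler01; apply=> // x.
by rewrite (bigD1 x)//= lerDl sumr_ge0 => // y _; exact: powR_ge0.
Qed.

(** Here f * f is a unit mass at 2 x0, plus twice a translate [tau] of [g], plus g * g. Off 2 x0, (2
    tau + c)^2 <= 8 tau^2 + 2 c^2; at 2 x0, where [tau] vanishes, the cross term 2 c is at most
    twice the sum of g^2. Hence 10 = 8 + 2. *)
Lemma energy_add_atom f (x0 : 'I_n) (g := fun x => if x == x0 then 0 else f x) :
  (forall x, 0 <= f x) -> f x0 = 1 ->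
  energy intv f <= 1 + 10 * (\sum_x g x ^+ 2) + 2 * energy intv g.
Proof.
move=> f0 fx0.
have g0 x : 0 <= g x by rewrite /g; case: ifP.
pose tau s := \sum_(y < n | (x0 + y == s)%N) g y.
have tau2 s : tau s ^+ 2 = \sum_(y < n | (x0 + y == s)%N) g y ^+ 2.
  rewrite /tau; case: (pickP (fun y : 'I_n => x0 + y == s)%N) => [y /eqP ys|no].
    have P1 : (fun z : 'I_n => x0 + z == s)%N =1 pred1 y.
      by move=> z; rewrite -ys eqn_add2l.
    by rewrite !(big_pred1 y P1).
  by rewrite !big_pred0// expr0n.
have convE s : conv f s = (s == x0 + x0)%N%:R + 2 * tau s + conv g s.
  have fE x : f x = (x == x0)%:R + g x.
    by rewrite /g; case: eqP => [->|_]; rewrite ?fx0 ?addr0 ?add0r.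
  have tau1 : \sum_(p : 'I_n * 'I_n | (p.1 + p.2 == s)%N) (p.1 == x0)%:R * g p.2 = tau s.
    rewrite -(pair_big_dep predT (fun x y : 'I_n => x + y == s)%N
       (fun x y => (x == x0)%:R * g y))/=.
    rewrite (bigD1 x0)//= [X in _ + X]big1 ?addr0.
      by apply: eq_bigr => y _; rewrite eqxx mul1r.
    by move=> x /negPf ->; rewrite big1// => y _; rewrite mul0r.
  have tau1' : \sum_(p : 'I_n * 'I_n | (p.1 + p.2 == s)%N) g p.1 * (p.2 == x0)%:R = tau s.
    rewrite -tau1 (reindex (fun p : 'I_n * 'I_n => (p.2, p.1)))/=; last first.
      by apply: onW_bij; exists (fun p : 'I_n * 'I_n => (p.2, p.1)) => -[].
    by apply: eq_big => p; [rewrite addnC|move=> _; rewrite mulrC].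
  have d2 : \sum_(p : 'I_n * 'I_n | (p.1 + p.2 == s)%N)
      ((p.1 == x0)%:R * (p.2 == x0)%:R : R) = (s == x0 + x0)%N%:R.
    rewrite -(pair_big_dep predT (fun x y : 'I_n => x + y == s)%N
       (fun x y => (x == x0)%:R * (y == x0)%:R))/=.
    rewrite (bigD1 x0)//= [X in _ + X]big1 ?addr0; last first.
      by move=> x /negPf ->; rewrite big1// => y _; rewrite mul0r.
    rewrite big_mkcond (bigD1 x0)//= [X in _ + X]big1 ?addr0.
      by rewrite eqxx mul1r eq_sym; case: eqP.
    by move=> y /negPf ->; rewrite mulr0 if_same.
  rewrite mulr_natl mulr2n -{1}tau1 -tau1' -d2 /conv -!big_split/=.
  by apply: eq_bigr => p _; rewrite !fE; ring.
have tau0 : tau (x0 + x0)%N = 0.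
  by rewrite /tau (big_pred1 x0) ?/g ?eqxx// => y; rewrite eqn_add2l.
have G0 : 0 <= \sum_x g x ^+ 2 by apply: sumr_ge0 => x _; exact: sqr_ge0.
have gc s : conv g s <= \sum_x g x ^+ 2.
  rewrite -(@ler_pXn2r _ 2)// ?nnegrE ?conv_ge0//.
  apply: le_trans (sum_CauchySchwarz _ _ _ _) _; rewrite [leRHS]expr2.
  apply: ler_pM; try by apply: sumr_ge0 => p _; exact: sqr_ge0.
    by apply: (@sum_antidiagonal1 _ _ (fun x => g x ^+ 2) _ _ s) => [x|p /eqP//];
      rewrite ?sqr_ge0.
  by apply: (@sum_antidiagonal2 _ _ (fun x => g x ^+ 2) _ _ s) => [x|p /eqP//];
      rewrite ?sqr_ge0.
have lt2 (y : 'I_n) := ltn_add_double x0 y.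
have tauS : \sum_(s < n.*2) tau s ^+ 2 = \sum_x g x ^+ 2.
  rewrite [RHS](partition_big (fun y => Ordinal (lt2 y)) predT)//=.
  by apply: eq_bigr => s _; rewrite tau2; apply: eq_bigl => y.
have -> : 1 + 10 * (\sum_x g x ^+ 2) + 2 * energy intv g =
   \sum_(s < n.*2) ((s == x0 + x0 :> nat)%N%:R * (1 + 2 * \sum_x g x ^+ 2) +
      8 * tau s ^+ 2 + 2 * conv g s ^+ 2).
  have -> : energy intv g = \sum_(s < n.*2) conv g s ^+ 2 by exact: energy_conv.
  rewrite !big_split/= -!mulr_sumr -mulr_suml tauS.
  have -> : \sum_(s < n.*2) (s == x0 + x0 :> nat)%N%:R = 1 :> R.
    rewrite (bigD1 (Ordinal (lt2 x0)))//= eqxx [X in _ + X]big1 ?addr0// => s.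
    by rewrite -val_eqE/= => /negPf ->.
  ring.
rewrite energy_conv; apply: ler_sum => s _; rewrite convE.
have c0 : 0 <= conv g s by apply: conv_ge0.
have [->|_] := eqVneq (s : nat) (x0 + x0)%N.
  rewrite /= tau0; have := gc (x0 + x0)%N.
  have := sqr_ge0 (conv g (x0 + x0)%N); rewrite !expr2; lra.
have := sqr_ge0 (2 * tau s - conv g s); rewrite /= !expr2; lra.
Qed.

(* [gap] separates the functions concentrated near one point, treated by
   [energy_add_atom], from the others, for which the spread form of Young's
   inequality with kappa = gap / 2 gains the factor 1 - young_gap. *)
Let gap : R := 10 ^- 4.
Definition young_gap : R := (gap / 2) ^+ 3 / 64.

Lemma young_gap_gt0 : 0 < young_gap.
Proof. by rewrite divr_gt0// exprn_gt0// divr_gt0// invr_gt0 exprn_gt0. Qed.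

Let gapE : gap = 10000^-1.
Proof. by rewrite /gap; congr (_^-1); ring. Qed.

Lemma young_gap_lt : young_gap < 1 / 10.
Proof. rewrite /young_gap gapE; lra. Qed.

(** With G the mass off the atom, the energy is at most 1 + 10 G^(t/2) + 4 G^t. Since t / 2 >= 5 / 4
    and G <= 10^-4, both powers are at most G / 10, so the total stays below (1 + G)^2 <= (1 +
    G)^t. *)
Lemma energy_near_atom f (x0 : 'I_n) (t : R) : (forall x, 0 <= f x) ->
  f x0 = 1 -> 5 / 2 <= t <= 3 -> n%:R `^ (3 - t) <= 2 ->
  \sum_(x | x != x0) f x `^ (4 / t) <= gap ->
  energy intv f <= (\sum_x f x `^ (4 / t)) `^ t.
Proof.
move=> f0 fx0 /andP[t5 t3] nt.
have tn0 : t != 0 by lra.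
have q0 : 4 / t != 0 :> R by rewrite mulf_neq0 ?invr_neq0.
set G := \sum_(x | _) _ => Gg.
rewrite [X in X `^ t](bigD1 x0)//= fx0 powR1 -/G.
have G0 : 0 <= G by apply: sumr_ge0 => x _; exact: powR_ge0.
have {}Gg : G <= 10^-1 ^+ 4 by rewrite exprVn.
apply: le_trans (energy_add_atom f0 fx0) _.
set g := fun x => if x == x0 then 0 else f x.
have g0 x : 0 <= g x by rewrite /g; case: ifP.
have gG : \sum_x g x `^ (4 / t) = G.
  rewrite (bigD1 x0)//= /g eqxx powR0// add0r.
  by apply: eq_bigr => x /negPf ->.
have G2 : \sum_x g x ^+ 2 <= G `^ (t / 2).
  have t2 : 1 <= t / 2 by lra.
  have := sum_powR_convex (fun x => powR_ge0 (g x) (4 / t)) t2.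
  rewrite gG; apply: le_trans; apply: ler_sum => x _.
  rewrite -powRrM (_ : 4 / t * (t / 2) = 2); last by field.
  by rewrite powR_mulrn.
have t03 : 0 < t <= 3 by lra.
have Eg : energy intv g <= 2 * G `^ t.
  apply: le_trans (energy_le_powR g0 t03) _.
  by rewrite gG ler_wpM2r ?powR_ge0.
have small a : 5 / 4 <= a -> G `^ a <= G / 10.
  move=> a54; have [->|GN0] := eqVneq G 0.
    by rewrite powR0 ?mul0r//; lra.
  have {}G0 : 0 < G by rewrite lt_neqAle eq_sym GN0.
  have G1 : G <= 1.
    by apply: le_trans Gg _; rewrite expr_le1//; lra.
  apply: (@le_trans _ _ (G `^ (1 + 4^-1))).
    by apply: ger_powR; rewrite ?G0//; lra.
  rewrite powRD ?(gt_eqF G0) ?implybT// powRr1 ?(ltW G0)// ler_wpM2l ?(ltW G0)//.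
  have -> : 10^-1 = (10^-1 ^+ 4) `^ (4^-1) :> R.
    by rewrite -powR_mulrn ?invr_ge0// -powRrM divff// powRr1// invr_ge0.
  by rewrite ge0_ler_powR ?nnegrE ?exprn_ge0 ?invr_ge0 ?(ltW G0).
have s1 : G `^ (t / 2) <= G / 10 by apply: small; lra.
have s2 : G `^ t <= G / 10 by apply: small; lra.
apply: (@le_trans _ _ ((1 + G) `^ 2)).
  by rewrite powR_mulrn ?addr_ge0//; nra.
by apply: ler_powR; lra.
Qed.

Lemma energy_le_one_dim f (t : R) : (forall x, 0 <= f x) ->
  5 / 2 <= t <= 3 -> n%:R `^ (3 - t) <= 1 + young_gap ->
  energy intv f <= (\sum_x f x `^ (4 / t)) `^ t.
Proof.
move=> f0 t53 nt; have /andP[t5 t3] := t53.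
have tn0 : t != 0 by lra.
have q0 : 4 / t != 0 :> R by rewrite mulf_neq0 ?invr_neq0.
have [[y fy]|fz] := pselect (exists y, f y != 0); last first.
  have {}fz x : f x = 0 by apply/eqP/negPn/negP => fx; apply: fz; exists x.
  by rewrite /energy /energy4 big1 ?powR_ge0// => q _; rewrite /qprod fz !mul0r.
case: (@Order.TotalTheory.arg_maxP _ _ _ y predT f isT) => x0 _ fmax.
have m0 : 0 < f x0.
  by apply: lt_le_trans (fmax y isT); rewrite lt_neqAle eq_sym fy f0.
(* Both sides are homogeneous of degree 4, so the maximum may be scaled to 1. *)
set m := f x0 in m0; pose g x := m^-1 * f x.
have g0 x : 0 <= g x by rewrite mulr_ge0// invr_ge0 (ltW m0).
have g1 x : g x <= 1 by rewrite /g mulrC ler_pdivrMr// mul1r; exact: fmax.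
have gx0 : g x0 = 1 by rewrite /g mulVf// gt_eqF.
suff : energy intv g <= (\sum_x g x `^ (4 / t)) `^ t.
  rewrite energyZ; under eq_bigr do rewrite powRM ?invr_ge0 ?(ltW m0)//.
  rewrite -mulr_sumr powRM ?powR_ge0 ?sumr_ge0// => [|x _]; last exact: powR_ge0.
  rewrite -powRrM divfK// powR_mulrn ?invr_ge0 ?(ltW m0)//.
  by rewrite ler_pM2l// exprn_gt0// invr_gt0.
have gap0 := young_gap_gt0; have gap1 := young_gap_lt.
have [near|far] := leP (\sum_(x | x != x0) g x `^ (4 / t)) gap.
  by apply: energy_near_atom near => //; lra.
have t03 : 0 < t <= 3 by lra.
set W := \sum_y g y `^ (4 / 3).
(* As g <= 1 and 4 / 3 <= 4 / t, passing to the exponent 4 / t does not lower the off-atom mass.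
   Then (1 - gap / 2) W >= 1 = max g^(4/3), the spread condition. *)
have Wg : 1 + gap <= W.
  rewrite /W (bigD1 x0)//= gx0 powR1 lerD2l; apply: le_trans (ltW far) _.
  apply: ler_sum => x _.
  have [->|gn0] := eqVneq (g x) 0; first by rewrite powR0// powR_ge0.
  apply: ger_powR; first by rewrite lt_neqAle eq_sym gn0 g0 g1.
  by rewrite ler_pM2l// lef_pV2 ?posrE//; lra.
have : energy intv g <= (1 - young_gap) * W ^+ 3.
  apply: energy_young_spread => //.
    by rewrite gapE; lra.
  move=> x; apply: (@le_trans _ _ 1).
    apply: (@le_trans _ _ (1 `^ (4 / 3))); last by rewrite powR1.
    by rewrite ge0_ler_powR ?nnegrE//.
  rewrite -/W; move: Wg; rewrite gapE; nra.
move/le_trans; apply.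
have U0 : 0 <= (\sum_x g x `^ (4 / t)) `^ t by exact: powR_ge0.
have := young_holder g0 t03; rewrite -/W => hW.
have {hW} : W ^+ 3 <= (1 + young_gap) * (\sum_x g x `^ (4 / t)) `^ t.
  by apply: le_trans hW _; rewrite ler_wpM2r.
have : 0 <= 1 - young_gap by lra.
move: (W ^+ 3) (_ `^ t) U0 young_gap gap0 => Z U U0 c c0 c1 hZ.
(* The gain absorbs the Hoelder loss: (1 - c) (1 + c) <= 1. *)
have := ler_wpM2l c1 hZ; have := mulr_ge0 (mulr_ge0 (ltW c0) (ltW c0)) U0; lra.
Qed.

Lemma energy4_le_one_dim f1 f2 f3 f4 (t : R) :
  (forall x, 0 <= f1 x) -> (forall x, 0 <= f2 x) ->
  (forall x, 0 <= f3 x) -> (forall x, 0 <= f4 x) ->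
  5 / 2 <= t <= 3 -> n%:R `^ (3 - t) <= 1 + young_gap ->
  energy4 intv f1 f2 f3 f4 <=
    pnorm t f1 * pnorm t f2 * pnorm t f3 * pnorm t f4.
Proof.
move=> h1 h2 h3 h4 t53 nt.
have normE (f : 'I_n -> R) : pnorm t f ^+ 4 = (\sum_x f x `^ (4 / t)) `^ t.
  by rewrite -powR_mulrn ?powR_ge0// -powRrM divfK.
have N0 (f : 'I_n -> R) : 0 <= pnorm t f by exact: powR_ge0.
have E0 f : (forall x, 0 <= f x) -> 0 <= energy intv f.
  by move=> f0; apply: energy4_ge0.
have P0 : 0 <= pnorm t f1 * pnorm t f2 * pnorm t f3 * pnorm t f4.
  by rewrite !mulr_ge0.
rewrite -(@ler_pXn2r _ 4 isT _ _ (energy4_ge0 intv h1 h2 h3 h4) P0).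
apply: le_trans (energy4_le _ h1 h2 h3 h4) _.
rewrite !exprMn; apply: ler_pM; [by rewrite !mulr_ge0 ?E0|exact: E0| |];
  last by rewrite normE; exact: energy_le_one_dim.
apply: ler_pM; [by rewrite !mulr_ge0 ?E0|exact: E0| |];
  last by rewrite normE; exact: energy_le_one_dim.
by apply: ler_pM; rewrite ?E0// normE; exact: energy_le_one_dim.
Qed.

End OneDimension.

(** * Tensorisation and the upper bound *)

(** Iterated products split off one coordinate by projection, as the induction on the dimension
    requires; [vec] identifies them with the points of the cube in Z^d. *)
Fixpoint cube (n d : nat) : finType :=
  if d is d'.+1 then ('I_n * cube n d')%type else unit.

Fixpoint vec (n d : nat) : cube n d -> 'rV[int]_d :=
  if d is d'.+1 return cube n d -> 'rV[int]_d then
    fun x => row_mx (const_mx (intv x.1) : 'rV_1) (vec x.2)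
  else fun=> 0.

Section Cube.
Variable n : nat.

Lemma vec_inj d : injective (@vec n d).
Proof.
elim: d => [[] []//|d IH] [x y] [x' y'] /= /(@eq_row_mx _ 1 1 d)[/rowP/(_ ord0)].
by rewrite !mxE => -[/val_inj ->] /IH ->.
Qed.

Lemma in_cube_vec d (x : cube n d) (i : 'I_d) : 0 <= vec x ord0 i < n%:Z.
Proof.
elim: d x i => [|d IH] x i; first by case: i.
rewrite /= mxE; case: splitP => j _; last exact: IH.
by rewrite mxE /intv lez_nat ltz_nat /=.
Qed.

Lemma vec_surj d (a : 'rV[int]_d) :
  (forall i, 0 <= a ord0 i < n%:Z) -> exists x : cube n d, a = vec x.
Proof.
elim: d a => [|d IH] a acube; first by exists tt; apply/rowP => -[].
pose a' : 'rV[int]_(1 + d) := a.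
have [|y yE] := IH (rsubmx a'); first by move=> i; rewrite mxE acube.
have /andP[] := acube ord0.
case aE: (a ord0 ord0) => [k|//] _; rewrite ltz_nat => kn.
exists (Ordinal kn, y); rewrite /= -yE -[LHS](@hsubmxK _ 1 1 d a').
apply: (f_equal2 (@row_mx _ 1 1 d)) => //.
apply/rowP => i; rewrite !mxE ord1 /intv/= -aE.
by congr (a _ _); apply: val_inj.
Qed.

Lemma additive_quad_vecS d (q : cube n d.+1 * cube n d.+1 * cube n d.+1 * cube n d.+1) :
  additive_quad (@vec n d.+1) q =
  additive_quad intv (q.1.1.1.1, q.1.1.2.1, q.1.2.1, q.2.1) &&
  additive_quad (@vec n d) (q.1.1.1.2, q.1.1.2.2, q.1.2.2, q.2.2).
Proof.
rewrite /additive_quad/=; apply/eqP/andP => [|[/eqP e1 /eqP e2]].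
  rewrite !(@add_row_mx _ 1 1 d) => /(@eq_row_mx _ 1 1 d)[/rowP/(_ ord0)].
  by rewrite !mxE => -> ->.
rewrite !(@add_row_mx _ 1 1 d) e2; apply: (f_equal2 (@row_mx _ 1 1 d)) => //.
by apply/rowP => i; rewrite !mxE.
Qed.

End Cube.

Section Tensor.
Context {R : realType} {n : nat}.

Lemma energy4_vecS d (f1 f2 f3 f4 : cube n d.+1 -> R) :
  energy4 (@vec n d.+1) f1 f2 f3 f4 =
  \sum_(q | additive_quad (@intv n) q)
    energy4 (@vec n d) (fun y => f1 (q.1.1.1, y)) (fun y => f2 (q.1.1.2, y))
      (fun y => f3 (q.1.2, y)) (fun y => f4 (q.2, y)).
Proof.
pose C := cube n d.
pose unzip4 (p : ('I_n * 'I_n * 'I_n * 'I_n) * (C * C * C * C)) :=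
  ((p.1.1.1.1, p.2.1.1.1), (p.1.1.1.2, p.2.1.1.2), (p.1.1.2, p.2.1.2), (p.1.2, p.2.2)).
rewrite /energy4 pair_big_dep/= (reindex unzip4)/=.
  by apply: eq_big => [p|p _]; rewrite ?additive_quad_vecS//=;
    case: p => [[[[? ?] ?] ?] [[[? ?] ?] ?]].
apply: onW_bij; exists (fun q => ((q.1.1.1.1, q.1.1.2.1, q.1.2.1, q.2.1),
    (q.1.1.1.2, q.1.1.2.2, q.1.2.2, q.2.2))).
  by move=> [[[[? ?] ?] ?] [[[? ?] ?] ?]].
by move=> [[[[? ?] [? ?]] [? ?]] [? ?]].
Qed.

Lemma energy4_vec0 (f1 f2 f3 f4 : cube n 0 -> R) :
  energy4 (@vec n 0) f1 f2 f3 f4 = f1 tt * f2 tt * f3 tt * f4 tt.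
Proof.
rewrite /energy4 (big_pred1 (tt, tt, tt, tt))// => -[[[[] []] []] []].
by rewrite /additive_quad/= !eqxx.
Qed.

Lemma pnorm_vecS (t : R) d (f : cube n d.+1 -> R) : t != 0 ->
  pnorm t (fun x : 'I_n => pnorm t (fun y => f (x, y))) = pnorm t f.
Proof.
move=> t0; rewrite /pnorm; congr (_ `^ _).
rewrite (eq_bigr (fun x : 'I_n => \sum_y f (x, y) `^ (4 / t))).
  by rewrite pair_big/=; apply: eq_bigr => -[].
move=> x _; rewrite -powRrM (_ : t / 4 * (4 / t) = 1); last by field.
by rewrite powRr1// sumr_ge0// => y _; exact: powR_ge0.
Qed.

(** The induction hypothesis bounds the form on slices by products of slice norms, the
    one-dimensional inequality applies to these norms as functions of the first coordinate, and
    [pnorm_vecS] reassembles them. Four functions are needed because the slices are taken at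
    different points. *)
Lemma energy4_le_pnorm (t : R) d (f1 f2 f3 f4 : cube n d -> R) :
  (forall x, 0 <= f1 x) -> (forall x, 0 <= f2 x) ->
  (forall x, 0 <= f3 x) -> (forall x, 0 <= f4 x) ->
  5 / 2 <= t <= 3 -> n%:R `^ (3 - t) <= 1 + young_gap ->
  energy4 (@vec n d) f1 f2 f3 f4 <=
    pnorm t f1 * pnorm t f2 * pnorm t f3 * pnorm t f4.
Proof.
move=> h1 h2 h3 h4 t53 nt; have t0 : t != 0 by case/andP: t53 => ? ?; lra.
elim: d => [|d IH] in f1 f2 f3 f4 h1 h2 h3 h4 *.
  have pE (f : cube n 0 -> R) : (forall x, 0 <= f x) -> pnorm t f = f tt.
    move=> f0; rewrite /pnorm (big_pred1 tt); last by case.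
    by rewrite -powRrM (_ : 4 / t * (t / 4) = 1) ?powRr1//; field.
  by rewrite energy4_vec0 !pE.
rewrite energy4_vecS -(pnorm_vecS f1 t0) -(pnorm_vecS f2 t0).
rewrite -(pnorm_vecS f3 t0) -(pnorm_vecS f4 t0).
apply: le_trans (energy4_le_one_dim _ _ _ _ t53 nt) => //;
  try by move=> x; exact: powR_ge0.
by apply: ler_sum => q _; exact: IH.
Qed.

End Tensor.

(** * Finite sets and their indicator functions *)

Lemma card_fset_preim (I : finType) (T : choiceType) (psi : I -> T) (B : {fset T}) :
  injective psi -> (forall b, b \in B -> exists x, b = psi x) ->
  #|` B|%fset = #|[pred x | psi x \in B]|.
Proof.
move=> psi_inj Bim.
rewrite cardE -(size_map psi); apply: perm_size; apply: uniq_perm => //.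
  by rewrite map_inj_uniq// enum_uniq.
move=> b; apply/idP/mapP => [bB|[x + ->]]; last by rewrite mem_enum inE.
by have [x bE] := Bim _ bB; exists x => //; rewrite mem_enum inE -bE.
Qed.

Section FsetEnergy.
Context {R : realType}.
Variables (I : finType) (V : zmodType) (phi : I -> V) (A : {fset V}).
Hypothesis phi_inj : injective phi.
Hypothesis A_im : forall a, a \in A -> exists x, a = phi x.

Lemma cardfs_sum : #|` A|%fset%:R = \sum_x (phi x \in A)%:R :> R.
Proof.
rewrite (card_fset_preim phi_inj A_im) -sum1_card natr_sum big_mkcond/=.
by apply: eq_bigr => x _; rewrite inE; case: ifP.
Qed.

Lemma additive_energyE :
  (additive_energy A)%:R = energy phi (fun x => (phi x \in A)%:R : R).
Proof.
pose psi (q : I * I * I * I) := (phi q.1.1.1, phi q.1.1.2, phi q.1.2, phi q.2).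
have psi_inj : injective psi.
  by move=> [[[? ?] ?] ?] [[[? ?] ?] ?] [/phi_inj-> /phi_inj-> /phi_inj-> /phi_inj->].
rewrite /additive_energy (card_fset_preim psi_inj); last first.
  move=> [[[a b] c] e]; rewrite !inE/= -!andbA => /and5P[].
  move=> /A_im[x ->] /A_im[y ->] /A_im[z ->] /A_im[u ->] _.
  by exists (x, y, z, u).
rewrite -sum1_card natr_sum/= big_mkcond/= /energy /energy4 [RHS]big_mkcond/=.
apply: eq_bigr => q _; rewrite !inE/= /additive_quad /qprod.
case: eqP => _; rewrite ?andbF// andbT.
by do 4 case: (_ \in A); rewrite /= ?mulr1 ?mulr0 ?mul0r.
Qed.

End FsetEnergy.

Lemma admissible_upper (R : realType) (n : nat) (t : R) : 5 / 2 <= t <= 3 ->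
  n%:R `^ (3 - t) <= 1 + young_gap :> R -> admissible_exponents n t.
Proof.
move=> t53 nt d A d0 Acube.
have A_im a : a \in A -> exists x : cube n d, a = vec x.
  by move=> aA; apply: vec_surj => i; exact: Acube.
have t0 : t != 0 by case/andP: t53 => ? ?; lra.
rewrite (additive_energyE (@vec_inj n d) A_im) (cardfs_sum (@vec_inj n d) A_im).
set f := fun x => _; have f0 x : 0 <= f x by exact: ler0n.
apply: le_trans (energy4_le_pnorm f0 f0 f0 f0 t53 nt) _.
have -> : pnorm t f = (\sum_x f x) `^ (t / 4).
  rewrite /pnorm; congr (_ `^ _); apply: eq_bigr => x _.
  by rewrite /f; case: (_ \in A); rewrite ?powR1// powR0// mulf_neq0 ?invr_neq0.
rewrite -{1}[X in X * _ * _ * _]expr1 -!exprSr -powR_mulrn ?powR_ge0//.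
by rewrite -powRrM divfK.
Qed.

Lemma energy_exponent_le (R : realType) (n : nat) : (2 <= n)%N ->
  energy_exponent R n <= 3 - log_base n%:R (1 + young_gap).
Proof.
move=> n2; apply: (energy_exponent_smallest R n2).2.
have c0 := @young_gap_gt0 R; have c1 := @young_gap_lt R.
have n1 : 1 < n%:R :> R by rewrite ltr1n.
have lnn : 0 < ln n%:R :> R by rewrite ln_gt0.
have lnc : 0 <= ln (1 + young_gap : R) by rewrite ln_ge0//; lra.
have l0 : 0 <= log_base n%:R (1 + young_gap) :> R by rewrite divr_ge0// ltW.
(* This keeps t >= 5 / 2; it holds because (1 + c)^2 <= 2 <= n for c < 1 / 10. *)
have l1 : log_base n%:R (1 + young_gap) <= 1 / 2 :> R.
  rewrite ler_pdivrMr// mulrC mul1r ler_pdivlMr// mulr_natr -lnXn; last by lra.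
  rewrite ler_ln ?posrE ?exprn_gt0//; [|by lra|by lra].
  have : 2 <= n%:R :> R by rewrite ler_nat.
  rewrite expr2; nra.
apply: admissible_upper; first by apply/andP; split; lra.
rewrite opprB addrC subrK /log_base.
rewrite -[leRHS]lnK ?posrE; last by lra.
rewrite -{1}[n%:R]lnK ?posrE; last by lra.
by rewrite -expRM mulrC divfK// gt_eqF.
Qed.

(** * Gaussian sums *)

Section GaussianSums.
Context {R : realType}.

(** The integral of exp(- u^2) for u from 0 to x. *)
Definition gauss_primitive (x : R) : R :=
  gauss_integral_proof.integral0_gauss x.

Lemma gauss_primitive0 : gauss_primitive 0 = 0.
Proof.
by rewrite /gauss_primitive /gauss_integral_proof.integral0_gauss set_itv1 Rintegral_set1.
Qed.

Lemma gauss_primitive_integrable (x : R) :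
  (@lebesgue_measure R).-integrable `[0, x] (EFin \o gauss_fun).
Proof.
apply: continuous_compact_integrable; first exact: segment_compact.
by apply: continuous_subspaceT; exact: continuous_gauss_fun.
Qed.

Lemma is_derive_gauss_primitive (x : R) : 0 < x ->
  is_derive x 1 gauss_primitive (gauss_fun x).
Proof.
move=> x0; have xx : x < x + 1 by rewrite ltrDl.
have [] := @continuous_FTC1 R gauss_fun (BLeft 0) x _ xx
  (gauss_primitive_integrable _) _ _.
- by rewrite /= lte_fin.
- exact: continuous_gauss_fun.
- by move=> d dE; apply: DeriveDef; [exact: d|rewrite -derive1E; exact: dE].
Qed.

Lemma gauss_increment (x y : R) : 0 <= x <= y ->
  expR (- y ^+ 2) * (y - x) <= gauss_primitive y - gauss_primitive x
    <= expR (- x ^+ 2) * (y - x).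
Proof.
move=> /andP[x0 xy].
have [||c] := @MVT_segment R gauss_primitive gauss_fun x y xy.
- move=> z; rewrite in_itv/= => /andP[xz zy].
  by apply: is_derive_gauss_primitive; exact: le_lt_trans xz.
- have : {within `[0, y], continuous gauss_primitive}.
    apply: parameterized_integral_continuous; first exact: le_trans xy.
    exact: gauss_primitive_integrable.
  by apply: continuous_subspaceW => z/=; rewrite !in_itv/= => /andP[/(le_trans x0)-> ->].
rewrite in_itv/= => /andP[xc cy] ->.
have c0 : 0 <= c by exact: le_trans xc.
rewrite /gauss_fun; apply/andP; split; apply: ler_wpM2r; rewrite ?subr_ge0//;
  by rewrite ler_expR lerN2 ler_pXn2r// nnegrE// (le_trans c0).
Qed.

Definition gauss_mass : R := Num.sqrt pi / 2.

Lemma gauss_mass_gt0 : 0 < gauss_mass.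
Proof. by rewrite divr_gt0// sqrtr_gt0 pi_gt0. Qed.

(** The square tends to pi / 4, and the primitive is nonnegative. *)
Lemma cvg_gauss_primitive : gauss_primitive x @[x --> +oo] --> gauss_mass.
Proof.
have : Num.sqrt (gauss_primitive x ^+ 2) @[x --> +oo] --> Num.sqrt (pi / 4 : R).
  apply: continuous_cvg; first exact: sqrt_continuous.
  exact: gauss_integral_proof.cvg_integral0_gauss_sqr.
rewrite sqrtrM ?pi_ge0// sqrtrV// (_ : 4 = 2 ^+ 2 :> R); last by ring.
rewrite sqrtr_sqr ger0_norm// -/gauss_mass.
rewrite (_ : (fun _ => Num.sqrt _) = gauss_primitive)//.
apply/funext => r; rewrite sqrtr_sqr ger0_norm//.
exact: gauss_integral_proof.integral0_gauss_ge0.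
Qed.

Lemma le_gauss_primitive (x y : R) : 0 <= x <= y ->
  gauss_primitive x <= gauss_primitive y.
Proof.
move=> xy; have /andP[+ _] := gauss_increment xy.
move=> h; rewrite -subr_ge0; apply: le_trans h.
by rewrite mulr_ge0 ?expR_ge0// subr_ge0; case/andP: xy.
Qed.

Lemma gauss_primitive_le (x : R) : 0 <= x -> gauss_primitive x <= gauss_mass.
Proof.
move=> x0; have <- := cvg_lim (@Rhausdorff R) cvg_gauss_primitive.
apply: limr_ge; first by apply/cvg_ex; exists gauss_mass; exact: cvg_gauss_primitive.
near=> y; apply: le_gauss_primitive; rewrite x0/=.
near: y; exact: nbhs_pinfty_ge (num_real x).
Unshelve. all: by end_near. Qed.

Definition gauss_sum (p : nat) (b : R) : R :=
  \sum_(v < p) expR (- (b * v.+1%:R ^+ 2)).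

(** A lower Riemann sum of mesh b, sampled at right endpoints of a decreasing function. *)
Lemma gauss_sum_le (p : nat) (b : R) : 0 < b ->
  b * gauss_sum p (b ^+ 2) <= gauss_mass.
Proof.
move=> b0; have bp : 0 <= b * p%:R by rewrite mulr_ge0// ltW.
apply: le_trans (gauss_primitive_le bp).
rewrite /gauss_sum; elim: p {bp} => [|p IH].
  by rewrite big_ord0 !mulr0 gauss_primitive0.
rewrite big_ord_recr/= (mulrDr b (\sum_(v < p) _)).
have bp : 0 <= b * p%:R <= b * p.+1%:R.
  by rewrite mulr_ge0 ?(ltW b0)//= ler_pM2l// ler_nat.
have /andP[+ _] := gauss_increment bp.
rewrite -mulrBr -natr1 addrAC subrr add0r mulr1 natr1 exprMn => h.
move: IH h; rewrite (mulrC b (expR _)); lra.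
Qed.

(** The same samples form an upper Riemann sum starting at b; the missing first cell has integral at
    most b. *)
Lemma gauss_sum_ge (p : nat) (b : R) : 0 < b ->
  gauss_primitive (b * p%:R) - b <= b * gauss_sum p (b ^+ 2).
Proof.
move=> b0.
have g1 : gauss_primitive b <= b.
  have b1 : (0 <= 0 :> R) && (0 <= b) by rewrite lexx ltW.
  have /andP[_] := gauss_increment b1.
  by rewrite gauss_primitive0 expr0n/= oppr0 expR0 mul1r !addr0.
suff : gauss_primitive (b * p.+1%:R) - gauss_primitive b <= b * gauss_sum p (b ^+ 2).
  have : gauss_primitive (b * p%:R) <= gauss_primitive (b * p.+1%:R).
    by apply: le_gauss_primitive; rewrite mulr_ge0 ?(ltW b0)//= ler_pM2l// ler_nat.
  lra.
rewrite /gauss_sum; elim: p => [|p IH].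
  by rewrite big_ord0 mulr0 mulr1 subrr.
rewrite big_ord_recr/= (mulrDr b (\sum_(v < p) _)).
have bp : 0 <= b * p.+1%:R <= b * p.+2%:R.
  by rewrite mulr_ge0 ?(ltW b0)//= ler_pM2l// ler_nat.
have /andP[_] := gauss_increment bp.
rewrite -mulrBr -(natr1 p.+1) addrAC subrr add0r mulr1 natr1 exprMn => h.
move: IH h; rewrite (mulrC b (expR _)); lra.
Qed.

End GaussianSums.

(** * From sets to functions by level sets *)

(** Tensor power trick. If X / Y = 1 + e with e > 0, take d = 5 k: Bernoulli gives (1 + e)^(5 k) >=
    (k e)^5, of degree 5 in k, against a factor at most (k C)^4; any k > C^4 / e^5 is a
    contradiction. *)
Lemma le_of_poly_growth (R : realType) (X Y : R) (B : nat) : 0 <= X -> 0 < Y ->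
  (forall d, (0 < d)%N -> X ^+ d <= (d * B).+1%:R ^+ 4 * Y ^+ d) -> X <= Y.
Proof.
move=> X0 Y0 XY; rewrite leNgt; apply/negP => YX.
pose e := X / Y - 1.
have e0 : 0 < e by rewrite subr_gt0 ltr_pdivlMr// mul1r.
have bern k : 1 + k%:R * e <= (1 + e) ^+ k.
  elim: k => [|k IH]; first by rewrite mul0r addr0 expr0.
  rewrite exprS -natr1; have e1 : 0 <= 1 + e by lra.
  apply: le_trans (ler_wpM2l e1 IH).
  have : 0 <= k%:R * (e * e) by rewrite !mulr_ge0// ltW.
  lra.
pose C : R := (5 * B).+1%:R.
have C0 : 0 < C by rewrite ltr0n.
have e5 : 0 < e ^+ 5 by rewrite exprn_gt0.
pose k := (Num.truncn (C ^+ 4 / e ^+ 5)).+1.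
have hk : C ^+ 4 / e ^+ 5 < k%:R by exact: truncnS_gt.
have k0 : (0 < k)%N by [].
have kp : 0 < k%:R :> R by rewrite ltr0n.
have k5 : (0 < k * 5)%N by rewrite muln_gt0.
have := XY _ k5; rewrite -ler_pdivrMr ?exprn_gt0// -expr_div_n.
have -> : X / Y = 1 + e by rewrite /e addrC subrK.
rewrite exprM => h.
have h1 : (k%:R * e) ^+ 5 <= ((1 + e) ^+ k) ^+ 5.
  rewrite ler_pXn2r// ?nnegrE ?exprn_ge0 ?mulr_ge0 ?(ltW e0)//; [|lra].
  by apply: le_trans (bern k); rewrite lerDr.
have h2 : ((k * 5 * B).+1%:R : R) ^+ 4 <= (k%:R * C) ^+ 4.
  rewrite ler_pXn2r// ?nnegrE ?mulr_ge0 ?(ltW C0)//.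
  by rewrite -natrM ler_nat -mulnA (mulnS k) -add1n leq_add2r.
have := le_trans h1 (le_trans h h2).
rewrite !exprMn (exprS _ 4) -mulrA (mulrCA k%:R) ler_pM2l ?exprn_gt0//.
by move: hk; rewrite ltr_pdivrMr// => /lt_le_trans h3 /h3; rewrite ltxx.
Qed.

Section Transfer.
Context {R : realType} {n : nat}.
Variables (lev : 'I_n -> nat) (lam : R).
Hypothesis lam01 : 0 < lam <= 1.

(** With integer powers of a single [lam], the d-th tensor power takes a number of values at most
    linear in d. *)
Let f (x : 'I_n) : R := lam ^+ lev x.
Let F : R := \sum_x f x `^ (4 / 3).

Fixpoint levels d : cube n d -> nat :=
  if d is d'.+1 return cube n d -> nat then
    fun x => (lev x.1 + levels x.2)%N
  else fun=> 0%N.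

Let fd d (x : cube n d) : R := lam ^+ levels x.

Let lam0 : 0 < lam. Proof. by case/andP: lam01. Qed.

Let fd_gt0 d (x : cube n d) : 0 < fd x. Proof. exact: exprn_gt0. Qed.

Let F_ge0 : 0 <= F. Proof. by apply: sumr_ge0 => x _; exact: powR_ge0. Qed.

Lemma energy_levels d : energy (@vec n d) (@fd d) = energy intv f ^+ d.
Proof.
elim: d => [|d IH]; first by rewrite /energy energy4_vec0 /fd/= !expr0 !mulr1.
rewrite exprS -IH /energy energy4_vecS mulr_suml; apply: eq_bigr => q _.
rewrite mulr_sumr; apply: eq_bigr => q' _.
rewrite /qprod /fd/= /f !exprD; ring.
Qed.

Lemma sum_levels d : \sum_(x : cube n d) fd x `^ (4 / 3) = F ^+ d.
Proof.
elim: d => [|d IH].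
  by rewrite (big_pred1 tt) /fd/= ?expr0 ?powR1//; case.
rewrite exprS -IH mulr_suml.
rewrite (eq_bigr (fun x : 'I_n => \sum_y fd (d := d.+1) (x, y) `^ (4 / 3))).
  by rewrite pair_big/=; apply: eq_bigr => -[].
move=> x _; rewrite mulr_sumr; apply: eq_bigr => y _.
by rewrite -powRM ?exprn_ge0 ?(ltW lam0)// /fd/= exprD.
Qed.

Definition level_set d (J : nat) : {fset 'rV[int]_d} :=
  [fset vec x | x : cube n d & levels x == J]%fset.

Lemma mem_level_set d J (x : cube n d) : (vec x \in level_set d J) = (levels x == J).
Proof.
apply/imfsetP/idP => /= [[y + /vec_inj ->]|xJ]; first by rewrite inE.
by exists x; rewrite // inE.
Qed.

Lemma level_set_vec d J a : a \in level_set d J -> exists x : cube n d, a = vec x.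
Proof. by move/imfsetP => [x _ ->]; exists x. Qed.

Lemma level_set_in_cube d J : in_cube n (level_set d J).
Proof. by move=> a /level_set_vec[x ->] i; exact: in_cube_vec. Qed.

Variable t : R.
Hypothesis t03 : 0 <= t <= 3.
Hypothesis t_adm : admissible_exponents n t.

Let layer d J (x : cube n d) : R := (levels x == J)%:R * lam ^+ J.

(** Admissibility gives at most lam^(4 J) |A|^t, while Markov's inequality gives |A| lam^(4 J / 3)
    <= F^d. Raised to the power t the latter suffices, as lam^(4 J) <= lam^(4 J t / 3) for lam <= 1
    and t <= 3. *)
Lemma energy_layer d J : (0 < d)%N -> energy (@vec n d) (layer J) <= (F ^+ d) `^ t.
Proof.
move=> d0; have /andP[t0 t3] := t03; have [l0 l1] := andP lam01.
have -> : layer (d := d) J = fun x => lam ^+ J * (vec x \in level_set d J)%:R.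
  by apply/funext => x; rewrite mem_level_set mulrC.
rewrite energyZ -(additive_energyE (@vec_inj n d) (@level_set_vec d J)).
set A := level_set d J; have AE := t_adm d0 (@level_set_in_cube d J).
have L0 : 0 < lam ^+ J by rewrite exprn_gt0.
have L1 : lam ^+ J <= 1 by rewrite exprn_ile1// ltW.
have AF : #|` A|%fset%:R * (lam ^+ J) `^ (4 / 3) <= F ^+ d.
  rewrite -sum_levels (cardfs_sum (R := R) (@vec_inj n d) (@level_set_vec d J)).
  rewrite mulr_suml; apply: ler_sum => x _; rewrite mem_level_set /fd.
  by case: eqP => [->|_]; rewrite ?mul1r// mul0r powR_ge0.
have := ge0_ler_powR t0 _ _ AF; rewrite !nnegrE mulr_ge0 ?powR_ge0// exprn_ge0//.
move=> /(_ isT isT); apply: le_trans; rewrite powRM ?powR_ge0// -powRrM mulrC.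
apply: ler_pM => //; first by rewrite exprn_ge0// ltW.
rewrite -(@powR_mulrn _ _ 4 (ltW L0)); apply: ger_powR; first by rewrite L0 L1.
lra.
Qed.

(* In dimension d there are O(d) layers, so splitting the tensor power of f
   into layers only costs a polynomial factor. *)
Lemma energy_le_of_admissible : energy intv f <= F `^ t.
Proof.
have /andP[t0 t3] := t03.
have [[i0 _]|noI] := pselect (exists i : 'I_n, True); last first.
  rewrite /energy /energy4 big1 ?powR_ge0// => q _.
  by exfalso; apply: noI; exists q.2.
have F0 : 0 < F.
  rewrite /F (bigD1 i0)//= ltr_pwDl ?powR_gt0 ?exprn_gt0// sumr_ge0// => x _.
  exact: powR_ge0.
pose B := \max_x lev x.
have levB d (x : cube n d) : (levels x < (d * B).+1)%N.
  rewrite ltnS; elim: d x => [//|d IH] [x y] /=.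
  by rewrite mulSn leq_add// /B leq_bigmax.
apply: (@le_of_poly_growth _ _ _ B).
- by apply: energy4_ge0 => x; rewrite exprn_ge0// ltW.
- by rewrite powR_gt0.
move=> d d0; rewrite -energy_levels.
have -> : (F `^ t) ^+ d = (F ^+ d) `^ t.
  rewrite -(@powR_mulrn _ _ d (powR_ge0 _ _)) -(@powR_mulrn _ _ d (ltW F0)).
  by rewrite -!powRrM mulrC.
pose M := (d * B).+1.
pose lv (x : cube n d) : 'I_M := Ordinal (levB d x).
pose lv4 (q : cube n d * cube n d * cube n d * cube n d) :=
  (lv q.1.1.1, lv q.1.1.2, lv q.1.2, lv q.2).
rewrite /energy /energy4 (partition_big lv4 predT)//=.
have lay0 J (x : cube n d) : 0 <= layer J x.
  by rewrite mulr_ge0// exprn_ge0// ltW.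
apply: (@le_trans _ _ (\sum_(j : 'I_M * 'I_M * 'I_M * 'I_M) (F ^+ d) `^ t)).
  apply: ler_sum => j _.
  apply: (@le_trans _ _ (energy4 (@vec n d) (layer (d := d) j.1.1.1)
      (layer (d := d) j.1.1.2) (layer (d := d) j.1.2) (layer (d := d) j.2))).
    rewrite /energy4 big_mkcondr/=; apply: ler_sum => q _.
    case: eqP => [<-|_]; last by rewrite /qprod !mulr_ge0 ?lay0 ?exprn_ge0 ?(ltW lam0).
    by rewrite /qprod /layer /fd/= !eqxx !mul1r.
  have E0 J : 0 <= energy (@vec n d) (layer J) by apply: energy4_ge0.
  have P0 : 0 <= (F ^+ d) `^ t by exact: powR_ge0.
  rewrite -(@ler_pXn2r _ 4 isT _ _ (energy4_ge0 _ _ _ _ _) P0);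
    try exact: lay0.
  (* Mixed energies of four different layers reduce to the energies of single layers. *)
  apply: le_trans (energy4_le _ _ _ _ _) _; try exact: lay0.
  have eL J := @energy_layer d J d0.
  rewrite (_ : _ ^+ 4 = (F ^+ d) `^ t * (F ^+ d) `^ t * (F ^+ d) `^ t * (F ^+ d) `^ t).
    apply: ler_pM; [by rewrite !mulr_ge0 ?E0|exact: E0| |exact: eL].
    apply: ler_pM; [by rewrite !mulr_ge0 ?E0|exact: E0| |exact: eL].
    by apply: ler_pM; [exact: E0|exact: E0|exact: eL|exact: eL].
  by rewrite !exprS expr0 mulr1 !mulrA.
rewrite sumr_const !card_prod !card_ord -[leLHS]mulr_natl.
by rewrite !natrM !exprS expr0 mulr1 !mulrA.
Qed.

End Transfer.

(** * The discrete Gaussian *)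

Lemma le_sum_inj (R : realDomainType) (I J : finType) (P : pred J) (psi : I -> J)
    (f : J -> R) :
  (forall x, 0 <= f x) -> injective psi -> (forall i, P (psi i)) ->
  \sum_i f (psi i) <= \sum_(x | P x) f x.
Proof.
move=> f0 psi_inj psiP.
have <- : \sum_(x in psi @: predT) f x = \sum_i f (psi i).
  by rewrite big_imset/= => [|? ? _ _]; [exact: eq_bigl|exact: psi_inj].
rewrite [leLHS]big_mkcond [leRHS]big_mkcond/=; apply: ler_sum => x _.
case: ifP => [/imsetP[i _ ->]|_]; first by rewrite psiP.
by case: ifP.
Qed.

Lemma sum_centered (R : realDomainType) (m : nat) (f : nat -> R) :
  \sum_(x < (m + m).+1) f ((x - m) + (m - x))%N = f 0%N + 2 * \sum_(v < m) f v.+1.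
Proof.
rewrite -(big_mkord xpredT (fun x => f ((x - m) + (m - x))%N)).
rewrite (@big_cat_nat _ _ _ m)//=; last by rewrite -addSn leq_addl.
have -> : \sum_(0 <= x < m) f ((x - m) + (m - x))%N = \sum_(v < m) f v.+1.
  rewrite big_nat_rev/= -(big_mkord xpredT (fun v => f v.+1)) !big_nat.
  by apply: eq_bigr => x xm; congr f; lia.
have -> : \sum_(m <= x < (m + m).+1) f ((x - m) + (m - x))%N =
    f 0%N + \sum_(v < m) f v.+1.
  rewrite -{1}[m]add0n big_addn -addSn addnK big_nat_recl//.
  rewrite -(big_mkord xpredT (fun v => f v.+1)); congr (_ + _).
    by congr f; lia.
  by apply: eq_bigr => x _; congr f; lia.
ring.
Qed.

Section DiscreteGaussian.
Context {R : realType}.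
Variable p : nat.

(** The sum of the two truncated differences is |x - 2 p|, so powers of exp(- a) along these levels
    sample a Gaussian centred in the interval. *)
Definition gauss_level (x : 'I_(4 * p).+1) : nat :=
  ((x - 2 * p) + (2 * p - x)) ^ 2.

Lemma gauss_levelE (b : R) (x : 'I_(4 * p).+1) :
  expR (- b) ^+ gauss_level x = expR (- (b * (x%:R - (2 * p)%:R) ^+ 2)).
Proof.
rewrite -expRM_natl mulrN mulrC; congr (expR (- (b * _))).
rewrite /gauss_level natrX natrD.
have [/ltnW xp|px] := ltnP x (2 * p)%N.
  by rewrite (eqP xp) add0r natrB// -sqrrN opprB.
by rewrite (eqP px) addr0 natrB.
Qed.

Lemma sum_gauss_level (b : R) :
  \sum_(x < (4 * p).+1) expR (- (b * (x%:R - (2 * p)%:R) ^+ 2)) =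
  1 + 2 * gauss_sum (2 * p) b.
Proof.
rewrite /gauss_sum.
have p4 : (4 * p = 2 * p + 2 * p)%N by lia.
have := sum_centered (2 * p) (fun k => expR (- (b * k%:R ^+ 2))).
rewrite -p4 expr0n/= mulr0 oppr0 expR0 => <-.
by apply: eq_bigr => x _; rewrite -gauss_levelE -expRM_natl mulrN mulrC natrX.
Qed.

Variable a : R.
Hypothesis a0 : 0 < a.

Let gval (x : nat) : R := expR (- (a * (x%:R - (2 * p)%:R) ^+ 2)).

Let gval_ge0 x : 0 <= gval x. Proof. exact: expR_ge0. Qed.

(** By the parallelogram law the exponent at (x, y) with x + y = 2 p + i is - (a / 2) ((i - 2 p)^2 +
    (x - y)^2). The pairs at distance at most 2 (v + 1), for v < p, each counted in both orders,
    give the bound. *)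
Lemma conv_gauss_ge (i : nat) : (i < (4 * p).+1)%N ->
  expR (- (a / 2 * (i%:R - (2 * p)%:R) ^+ 2)) * (2 * gauss_sum p (2 * a)) <=
  conv (fun x : 'I_(4 * p).+1 => gval x) (2 * p + i).
Proof.
move=> ip.
(* The two rounded halves of the sum handle both parities. As p <= h' and h <= 3 p, moving apart by
   at most p stays in the interval. *)
pose h := ((2 * p + i)./2)%N; pose h' := (2 * p + i - h)%N.
pose x v : 'I_(4 * p).+1 := inord (h + v.+1).
pose y v : 'I_(4 * p).+1 := inord (h' - v.+1).
pose psi (bv : bool * 'I_p) := if bv.1 then (x bv.2, y bv.2) else (y bv.2, x bv.2).
have hh : (h' = h \/ h' = h.+1) /\ (h + h' = 2 * p + i)%N.
  by rewrite /h' /h; have := odd_double_half (2 * p + i); case: odd; lia.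
have xE (v : 'I_p) : x v = (h + v.+1)%N :> nat.
  by rewrite inordK//; have := ltn_ord v; lia.
have yE (v : 'I_p) : y v = (h' - v.+1)%N :> nat.
  by rewrite inordK//; have := ltn_ord v; lia.
have vh (v : 'I_p) : (v.+1 <= h')%N by have := ltn_ord v; lia.
apply: (@le_trans _ _ (\sum_(bv : bool * 'I_p) gval (psi bv).1 * gval (psi bv).2)).
  rewrite -(pair_big predT predT
    (fun b (v : 'I_p) => gval (psi (b, v)).1 * gval (psi (b, v)).2))/=.
  rewrite big_bool/= /psi/=.
  rewrite [X in _ <= _ + X](eq_bigr
    (fun v : 'I_p => gval (x v) * gval (y v))); last first.
    by move=> v _; rewrite mulrC.
  rewrite (_ : forall e S : R, e * (2 * S) = e * S + e * S); last by move=> ? ?; ring.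
  rewrite /gauss_sum.
  suff h2 : expR (- (a / 2 * (i%:R - (2 * p)%:R) ^+ 2)) *
      \sum_(v < p) expR (- (2 * a * v.+1%:R ^+ 2)) <=
      \sum_(v < p) gval (x v) * gval (y v) by apply: lerD; exact: h2.
  rewrite mulr_sumr; apply: ler_sum => v _; rewrite /gval -!expRD ler_expR.
  have e1 : (x v)%:R + (y v)%:R = (2 * p)%:R + i%:R :> R.
    by rewrite -!natrD xE yE; congr _%:R; have := vh v; lia.
  have e2 : 0 <= (x v)%:R - (y v)%:R :> R.
    by rewrite subr_ge0 ler_nat xE yE; lia.
  have e3 : (x v)%:R - (y v)%:R <= 2 * v.+1%:R :> R.
    by rewrite lerBlDl -natrM -natrD ler_nat xE yE; have := vh v; lia.
  move: ((x v)%:R : R) ((y v)%:R : R) e1 e2 e3 => X Y e1 e2 e3.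
  have iE : i%:R = X + Y - (2 * p)%:R :> R by lra.
  rewrite iE; move: ((2 * p)%:R) (v.+1%:R : R) e3 => q w e3.
  have hw : (X - Y) ^+ 2 <= 4 * w ^+ 2.
    have w0 : 0 <= 2 * w by lra.
    have -> : 4 * w ^+ 2 = (2 * w) ^+ 2 by ring.
    by rewrite ler_pXn2r ?nnegrE.
  have := ler_wpM2l (ltW a0) hw; lra.
apply: (@le_sum_inj R _ _
  (fun q : 'I_(4 * p).+1 * 'I_(4 * p).+1 => (q.1 + q.2 == 2 * p + i)%N) psi
  (fun q => gval q.1 * gval q.2)).
- by move=> q; rewrite mulr_ge0.
- move=> [b v] [b' v'] /(congr1 (fun q : 'I_(4 * p).+1 * 'I_(4 * p).+1 =>
    (val q.1, val q.2))); rewrite /psi/=.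
  have := vh v; have := vh v'.
  case: b; case: b' => /= ? ?; rewrite !xE !yE => -[? ?];
    by [congr pair; apply: val_inj => /=; lia|lia].
- move=> [b v]; rewrite /psi/=; have := vh v.
  by case: b => /= ?; rewrite xE yE; apply/eqP; lia.
Qed.

(** Keep only the sums 2 p + i. Squaring [conv_gauss_ge] turns a / 2 into a, and the sum over i is 1
    + 2 [gauss_sum (2 * p) a], whose 1 is dropped. *)
Lemma energy_gauss_ge :
  8 * gauss_sum (2 * p) a * gauss_sum p (2 * a) ^+ 2 <=
  energy intv (fun x => expR (- a) ^+ gauss_level x).
Proof.
have -> : (fun x => expR (- a) ^+ gauss_level x) =
    (fun x : 'I_(4 * p).+1 => gval x).
  by apply/funext => x; rewrite gauss_levelE.
rewrite energy_conv.
have gs0 k b : 0 <= gauss_sum k b :> R.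
  by apply: sumr_ge0 => ? _; exact: expR_ge0.
have lt2 (i : 'I_(4 * p).+1) : (2 * p + i < ((4 * p).+1).*2)%N.
  by have := ltn_ord i; lia.
have inj2 : injective (fun i => Ordinal (lt2 i)).
  by move=> i j [] /addnI ij; apply: val_inj.
apply: le_trans (@le_sum_inj R _ _ predT _
  (fun s : 'I_((4 * p).+1).*2 => conv (fun x : 'I_(4 * p).+1 => gval x) s ^+ 2)
  _ inj2 _) => //; last by move=> s; exact: sqr_ge0.
apply: (@le_trans _ _ (\sum_(i < (4 * p).+1)
    expR (- (a * (i%:R - (2 * p)%:R) ^+ 2)) * (4 * gauss_sum p (2 * a) ^+ 2))).
  rewrite -mulr_suml sum_gauss_level.
  have := sqr_ge0 (gauss_sum p (2 * a)); lra.
apply: ler_sum => i _ /=.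
have := conv_gauss_ge (ltn_ord i) => h.
have : 0 <= expR (- (a / 2 * (i%:R - (2 * p)%:R) ^+ 2)) * (2 * gauss_sum p (2 * a)).
  by rewrite !mulr_ge0 ?expR_ge0.
move=> h0; have c0 := le_trans h0 h.
move: h; rewrite -(@ler_pXn2r _ 2 isT _ _ h0 c0) => h; apply: le_trans h.
rewrite exprMn -expRM_natl exprMn le_eqVlt; apply/orP; left; apply/eqP.
by congr (expR _ * _); field.
Qed.

End DiscreteGaussian.

(** Take a = al^2 with al = lam / p. Riemann sums give al F <= sqrt 3 K exp delta and al^3 E >= 4 (K
    exp(- delta))^3; dividing the cube of the first by the second gives the constant and the factor
    exp(6 delta). *)
Lemma gauss_extremizer (R : realType) (delta : R) : 0 < delta ->
  exists c : R, exists p0 : nat, 0 < c /\ forall p, (p0 <= p)%N ->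
  exists2 a : R, 0 < a &
    let f x := expR (- a) ^+ @gauss_level p x in
    let F := \sum_x f x `^ (4 / 3) in
    c * p%:R <= F /\
    F ^+ 3 <= 3 * Num.sqrt 3 / 4 * expR (6 * delta) * energy intv f.
Proof.
move=> d0; set K : R := gauss_mass; have K0 : 0 < K := gauss_mass_gt0.
set s3 : R := Num.sqrt 3.
have s30 : 0 < s3 by rewrite sqrtr_gt0.
have s3E : s3 ^+ 2 = 3 by rewrite sqr_sqrtr.
set s2 : R := Num.sqrt 2.
have s20 : 0 < s2 by rewrite sqrtr_gt0.
have s2E : s2 ^+ 2 = 2 by rewrite sqr_sqrtr.
have s31 : 1 <= s3 <= 2 by apply/andP; split; rewrite expr2 in s3E; nra.
have s21 : 1 <= s2 <= 2 by apply/andP; split; rewrite expr2 in s2E; nra.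
pose D := K * expR (- delta); have D0 : 0 < D by rewrite mulr_gt0 ?expR_gt0.
have DK : D < K by rewrite -[ltRHS]mulr1 ltr_pM2l// expR_lt1 oppr_lt0.
have [lam lam0 lamD] : exists2 lam : R, 0 < lam & D < gauss_primitive lam.
  have [M [_ hM]] := @cvgr_gt _ _ _ _ _ _ cvg_gauss_primitive _ DK.
  exists (Num.max M 0 + 1).
    by rewrite ltr_wpDl// le_max lexx orbT.
  by apply: hM; rewrite ltr_pwDr// le_max lexx.
(* Two bounds on the mesh [al]: below [a1] the Riemann sums, which lose at most 2 al, stay above
   [D]; below [a2] the central term of F, contributing [al], is absorbed by exp delta. *)
pose a1 := (gauss_primitive lam - D) / 2; have a10 : 0 < a1 by rewrite divr_gt0 ?subr_gt0.
pose a2 := s3 * K * (expR delta - 1).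
have a20 : 0 < a2 by rewrite mulr_gt0 ?subr_gt0 ?expR_gt1// mulr_gt0.
exists (D / (2 * lam)), (Num.truncn (lam / a1 + lam / a2)).+1.
split; first by rewrite divr_gt0// mulr_gt0.
move=> p pp0.
have p1 : lam / a1 + lam / a2 < p%:R.
  by apply: lt_le_trans (truncnS_gt _) _; rewrite ler_nat.
have la1 : 0 < lam / a1 by rewrite divr_gt0.
have la2 : 0 < lam / a2 by rewrite divr_gt0.
have p0 : 0 < p%:R :> R by lra.
pose al := lam / p%:R; have al0 : 0 < al by rewrite divr_gt0.
have al1 : al <= a1.
  rewrite ler_pdivrMr// mulrC -ler_pdivrMr//; lra.
have al2 : al <= a2.
  rewrite ler_pdivrMr// mulrC -ler_pdivrMr//; lra.
have alp : al * p%:R = lam by rewrite divfK// gt_eqF.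
clearbody al; exists (al ^+ 2); first by rewrite exprn_gt0.
move=> f F.
(* The power 4 / 3 of the Gaussian of parameter al^2 has parameter b^2 = 4 al^2 / 3. *)
pose b := 2 * al / s3; have b0 : 0 < b by rewrite divr_gt0// mulr_gt0.
have bE : b * s3 = 2 * al by rewrite divfK// gt_eqF.
have b2E : b ^+ 2 = 4 / 3 * al ^+ 2.
  by rewrite expr_div_n s3E exprMn; field.
clearbody b; have bal : b <= 2 * al by rewrite -bE ler_peMr ?(ltW b0)//; case/andP: s31.
have alb : al <= b by rewrite -(@ler_pM2l _ 2)// -bE mulrC ler_pM2r//; case/andP: s31.
have FE : F = 1 + 2 * gauss_sum (2 * p) (b ^+ 2).
  rewrite b2E -sum_gauss_level; apply: eq_bigr => x _.
  by rewrite /f gauss_levelE -expRM; congr expR; ring.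
have Phi_ge x c : 0 < c -> 2 * al >= c -> lam <= x -> D <= gauss_primitive x - c.
  move=> c0 cal lx.
  have : gauss_primitive lam <= gauss_primitive x.
    by apply: le_gauss_primitive; rewrite (ltW lam0).
  move: al1; rewrite /a1; lra.
have g1 : D <= al * gauss_sum (2 * p) (al ^+ 2).
  apply: le_trans (gauss_sum_ge _ al0); apply: Phi_ge => //; first by lra.
  by rewrite natrM mulrCA alp; lra.
have g2 : D <= s2 * al * gauss_sum p (2 * al ^+ 2).
  have sal : 0 < s2 * al by rewrite mulr_gt0.
  rewrite -s2E -exprMn; apply: le_trans (gauss_sum_ge _ sal); apply: Phi_ge => //.
    by rewrite ler_pM2r//; case/andP: s21.
  by rewrite -mulrA alp ler_peMl ?(ltW lam0)//; case/andP: s21.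
have g3 : D <= b * gauss_sum (2 * p) (b ^+ 2).
  apply: le_trans (gauss_sum_ge _ b0); apply: Phi_ge => //.
  rewrite natrM -alp; apply: ler_pM; rewrite ?(ltW al0) ?(ltW p0)//.
  by rewrite ler_peMl// ?(ltW p0)//; lra.
have g4 : b * gauss_sum (2 * p) (b ^+ 2) <= K by exact: gauss_sum_le.
set G1 := gauss_sum (2 * p) (al ^+ 2) in g1.
set G2 := gauss_sum p (2 * al ^+ 2) in g2.
set G3 := gauss_sum (2 * p) (b ^+ 2) in g3 g4 FE.
have alp' : p%:R = lam / al by rewrite -alp mulrAC divff ?mul1r// gt_eqF.
split.
  rewrite FE alp' (_ : D / (2 * lam) * (lam / al) = D / (2 * al)); last first.
    by field; rewrite !gt_eqF.
  have : D / (2 * al) <= G3.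
    have al20 : 0 < 2 * al by rewrite mulr_gt0.
    rewrite (ler_pdivrMr _ _ al20) [leRHS]mulrC; apply: le_trans g3 _.
    rewrite ler_wpM2r//.
    by apply: sumr_ge0 => ? _; exact: expR_ge0.
  have : 0 <= G3 by apply: sumr_ge0 => ? _; exact: expR_ge0.
  lra.
have EG : 4 * D ^+ 3 <= al ^+ 3 * energy intv f.
  have := energy_gauss_ge p (exprn_gt0 2 al0); rewrite -/f -/G1 -/G2 => hE.
  have al3 : 0 < al ^+ 3 by rewrite exprn_gt0.
  apply: le_trans (ler_wpM2l (ltW al3) hE).
  have -> : al ^+ 3 * (8 * G1 * G2 ^+ 2) = 4 * ((al * G1) * (s2 * al * G2) ^+ 2).
    by rewrite !exprMn s2E; ring.
  rewrite ler_pM2l// exprS; apply: ler_pM => //; rewrite ?exprn_ge0 ?(ltW D0)//.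
  by rewrite ler_pXn2r ?nnegrE ?(ltW D0)//; apply: le_trans g2; exact: ltW.
have FG : al * F <= s3 * K * expR delta.
  have -> : al * F = al + s3 * (b * G3).
    by rewrite FE mulrDr mulr1 [in RHS]mulrA (mulrC s3) bE; ring.
  apply: (@le_trans _ _ (a2 + s3 * K)); last by rewrite /a2; lra.
  by apply: lerD => //; rewrite ler_pM2l.
have F0 : 0 <= F by apply: sumr_ge0 => x _; exact: powR_ge0.
have al3 : 0 < al ^+ 3 by rewrite exprn_gt0.
rewrite -(ler_pM2l al3) -exprMn.
apply: (@le_trans _ _ ((s3 * K * expR delta) ^+ 3)).
  rewrite ler_pXn2r ?nnegrE//; first by rewrite mulr_ge0// ltW.
  by rewrite !mulr_ge0 ?expR_ge0 ?(ltW K0) ?(ltW s30).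
apply: (@le_trans _ _ (3 * s3 / 4 * expR (6 * delta) * (4 * D ^+ 3))).
  rewrite /D !exprMn -!expRM_natl (exprSr s3 2) s3E.
  rewrite (_ : expR (3 * delta) = expR (6 * delta) * expR (3 * - delta)); last first.
    by rewrite -expRD; congr expR; ring.
  by rewrite le_eqVlt; apply/orP; left; apply/eqP; field.
rewrite [leRHS]mulrCA ler_wpM2l// !mulr_ge0 ?expR_ge0 ?(ltW s30)//.
Qed.

(** * Asymptotics of the exponent *)

Lemma admissible_exponents_le (R : realType) (m n : nat) (t : R) : (m <= n)%N ->
  admissible_exponents n t -> admissible_exponents m t.
Proof.
move=> mn tn d A d0 Am; apply: tn => // a aA i.
by have /andP[-> /lt_le_trans->] := Am a aA i.
Qed.

Lemma admissible_exponents_ge0 (R : realType) (n : nat) (t : R) : (2 <= n)%N ->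
  admissible_exponents n t -> 0 <= t.
Proof.
move=> n2 tn; pose A : {fset 'rV[int]_1} := [fset vec x | x : cube n 1]%fset.
have AE : #|` A|%fset = n.
  rewrite card_imfset/=; last exact: vec_inj.
  by rewrite -cardE card_prod card_ord card_unit muln1.
have : (1 : R) <= n%:R `^ t.
  have Acube : in_cube n A by move=> a /imfsetP[x _ ->] i; exact: in_cube_vec.
  rewrite -{1}AE; apply: le_trans (tn 1%N A isT Acube).
  have [a aA] : exists a, a \in A by apply/fset0Pn; rewrite -cardfs_gt0 AE ltnW.
  by rewrite ler1n; exact: additive_energy_gt0 aA.
have n1 : 1 < n%:R :> R by rewrite ltr1n.
rewrite -ler_ln ?posrE ?powR_gt0//; last by lra.
by rewrite ln1 ln_powR pmulr_lge0// ln_gt0.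
Qed.

Lemma quarter_bounds (n k : nat) : (8 <= n)%N -> (4 * k.+1 <= n)%N ->
  exists p, [/\ (4 * p).+1 <= n, n <= 8 * p & k <= p]%N.
Proof. by move=> n8 kn; exists ((n - 1) %/ 4)%N; split; lia. Qed.

(** Combining the extremizer with E <= F^t and taking logarithms gives (3 - t) ln F <= L + 6 d, and
    ln F >= ln n - C because F grows linearly in n. The error (3 - t) C takes up the seventh d. *)
Lemma energy_exponent_gap (R : realType) (delta : R) : 0 < delta ->
  exists n0 : nat, forall n, (n0 <= n)%N ->
    (3 - energy_exponent R n) * ln n%:R <= ln (3 * Num.sqrt 3 / 4) + delta.
Proof.
move=> delta0; set L : R := ln _.
pose d := delta / 7; have d0 : 0 < d by rewrite divr_gt0.
have [c [p0 [c0 ext]]] := gauss_extremizer d0.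
pose B := `|L + 6 * d|; pose C := `|ln (c / 8)|.
have B0 : 0 <= B by exact: normr_ge0.
have C0 : 0 <= C by exact: normr_ge0.
(* For ln n >= X, the summand 2 C gives (3 - t) ln n <= 2 B, the second then gives (3 - t) C <= d,
   and the 1 forces t = 3 when B = 0. *)
pose X := 2 * C + 2 * B * C / d + 1.
have BCd : 0 <= 2 * B * C / d by rewrite divr_ge0 ?(ltW d0)// !mulr_ge0.
have X0 : 0 < X by rewrite /X; lra.
exists (maxn (maxn 8 (4 * p0.+1)) (Num.truncn (expR X)).+1) => n.
rewrite !geq_max -!andbA => /and3P[n8 np0 nX].
have n2 : (2 <= n)%N by exact: leq_trans n8.
set t := energy_exponent R n; have [t_adm _] := energy_exponent_smallest R n2.
have t0 : 0 <= t by exact: admissible_exponents_ge0 t_adm.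
have n1 : 1 < n%:R :> R by rewrite ltr1n.
have lnn : 0 < ln n%:R :> R by rewrite ln_gt0.
have t3 : t <= 3.
  apply: le_trans (energy_exponent_le R n2) _; rewrite gerBl divr_ge0 ?(ltW lnn)//.
  by rewrite ln_ge0// lerDl ltW// young_gap_gt0.
have lnX : X <= ln n%:R.
  rewrite -[X]expRK ler_ln ?posrE ?expR_gt0//; last by lra.
  by apply/ltW/(lt_le_trans (truncnS_gt _)); rewrite ler_nat.
have [p [pn np pp0]] := quarter_bounds n8 np0.
have [a a0] := ext p pp0; cbv zeta => -[Fc FE].
have lam01 : 0 < expR (- a) <= 1 by rewrite expR_gt0 expR_le1 oppr_le0 ltW.
have t03 : 0 <= t <= 3 by rewrite t0 t3.
have := @energy_le_of_admissible R _ (@gauss_level p) _ lam01 _ t03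
  (admissible_exponents_le pn t_adm).
move: Fc FE; set F := \sum_x _; set E := energy _ _ => Fc FE EF.
have cn : c / 8 * n%:R <= F.
  apply: le_trans Fc; rewrite mulrAC ler_pdivrMr// -mulrA ler_pM2l//.
  by rewrite mulrC -natrM ler_nat.
have cn0 : 0 < c / 8 * n%:R by rewrite mulr_gt0 ?divr_gt0//; lra.
have F0 : 0 < F by exact: lt_le_trans cn.
have lnF : ln n%:R - C <= ln F.
  have : ln (c / 8 * n%:R) <= ln F by rewrite ler_ln ?posrE.
  rewrite lnM ?posrE ?divr_gt0//; last by lra.
  have : - ln (c / 8) <= C by rewrite /C -normrN ler_norm.
  lra.
have s0 : 0 < 3 * Num.sqrt 3 / 4 :> R by rewrite divr_gt0// mulr_gt0// sqrtr_gt0.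
have uF : (3 - t) * ln F <= L + 6 * d.
  have : F ^+ 3 <= 3 * Num.sqrt 3 / 4 * expR (6 * d) * F `^ t.
    by apply: le_trans FE _; rewrite ler_wpM2l// mulr_ge0 ?expR_ge0// ltW.
  rewrite -ler_ln ?posrE ?exprn_gt0 ?mulr_gt0 ?expR_gt0 ?powR_gt0//.
  rewrite lnXn// lnM ?posrE ?powR_gt0 ?mulr_gt0 ?expR_gt0//.
  rewrite lnM ?posrE ?expR_gt0// expRK ln_powR -/L -(mulr_natl (ln F)); lra.
have u0 : 0 <= 3 - t by lra.
have uB : (3 - t) * ln n%:R <= L + 6 * d + (3 - t) * C.
  by have := ler_wpM2l u0 lnF; lra.
have LB : L + 6 * d <= B by exact: ler_norm.
have uC : (3 - t) * C <= d.
  have h1 : (3 - t) * X <= 2 * B.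
    have : 0 <= (3 - t) * (ln n%:R - X) by rewrite mulr_ge0// subr_ge0.
    have : (3 - t) * (2 * C) <= (3 - t) * ln n%:R.
      by apply: ler_wpM2l => //; move: lnX; rewrite /X; lra.
    lra.
  have h2 : (3 - t) * (2 * B * C / d) <= 2 * B.
    by apply: le_trans h1; apply: ler_wpM2l => //; rewrite /X; lra.
  have [BZ|BN0] := eqVneq B 0.
    have : (3 - t) * 1 <= (3 - t) * X.
      by apply: ler_wpM2l => //; rewrite /X; lra.
    move: h1; rewrite BZ mulr0 mulr1 => h1 h3.
    have -> : 3 - t = 0 by lra.
    by rewrite mul0r ltW.
  have Bp : 0 < 2 * B by rewrite mulr_gt0// lt_neqAle eq_sym BN0.
  move: h2; rewrite !mulrA ler_pdivrMr// => h2.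
  by rewrite -(ler_pM2l Bp); lra.
rewrite (_ : delta = 7 * d); last by rewrite /d mulrC divfK.
lra.
Qed.

Theorem theorem1p1 (R : realType) :
  exists (c : R) (eta : nat -> R),
    [/\ 0 < c,
        eta n @[n --> \oo] --> (0 : R) &
        forall n : nat, (2 <= n)%N ->
          3 - (1 + eta n) * log_base n%:R (3 * Num.sqrt 3 / 4)
            <= energy_exponent R n
            <= 3 - log_base n%:R (1 + c)].
Proof.
set L : R := ln (3 * Num.sqrt 3 / 4).
have L0 : 0 < L.
  rewrite ln_gt0//; suff : 4 / 3 < Num.sqrt 3 :> R by lra.
  by rewrite -(@ltr_pXn2r _ 2) ?nnegrE ?sqrtr_ge0 ?divr_ge0// sqr_sqrtr//; lra.
(* The second argument is the value that turns the lower bound into an equality; the maximum with 0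
   makes the one-sided estimate of [energy_exponent_gap] enough for convergence. *)
pose eta (n : nat) : R := Num.max 0 ((3 - energy_exponent R n) * ln n%:R / L - 1).
exists young_gap, eta; split; first exact: young_gap_gt0.
  apply/cvgr0Pnorm_le => e e0.
  have eL : 0 < e * L by rewrite mulr_gt0.
  have [n0 hn0] := energy_exponent_gap eL.
  exists n0 => // n /= /hn0 h; rewrite ger0_norm ?le_max ?lexx//.
  by rewrite ge_max (ltW e0) lerBlDl ler_pdivrMr// (mulrDl 1 e L) mul1r.
move=> n n2; rewrite energy_exponent_le// andbT.
have lnn : 0 < ln n%:R :> R by rewrite ln_gt0// ltr1n.
rewrite /log_base -/L lerBlDr -lerBlDl mulrA ler_pdivlMr// -ler_pdivrMr//.
by rewrite -lerBlDl /eta le_max lexx orbT.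
Qed.
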